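(* Let $\varphi\in A_\infty(\Omega)$ be a Musielak–Orlicz function of uniformly lower type $p_\varphi^-$ and uniformly upper type $p_\varphi^+$ with $q(\varphi)<p_\varphi^-\le p_\varphi^+<\infty$. Then for every $r\in(1,\infty)$ there is $C>0$ such that for every sequence $(f_j)_{j\in\mathbb N}$ of measurable functions, $$\Big\|\Big\{\sum_{j\in\mathbb N}[M(f_j)]^r\Big\}^{1/r}\Big\|_{L^\varphi(\Omega)}\le C\Big\|\Big(\sum_{j\in\mathbb N}|f_j|^r\Big)^{1/r}\Big\|_{L^\varphi(\Omega)}.$$
   Context: Let $(\Omega,\mathcal F,\mathbb P)$ be a probability space, $(\mathcal F_n)_{n\in\mathbb Z_+}$ a nondecreasing sequence of sub-$\sigma$-algebras of $\mathcal F$, $\mathbb E_n$ the conditional expectation w.r.t. $\mathcal F_n$, and $M(f):=\sup_{n\in\mathbb Z_+}|\mathbb E_n f|$. A Musielak–Orlicz function is $\varphi:\Omega\times[0,\infty)\to[0,\infty)$ with $\varphi(x,\cdot)$ nondecreasing, $\varphi(x,0)=0$, $\lim_{t\to\infty}\varphi(x,t)=\infty$ for each $x$ and $\varphi(\cdot,t)$ measurable (positive, integrable) for each $t$. $\|f\|_{L^\varphi(\Omega)}:=\inf\{\lambda>0:\int_\Omega\varphi(x,|f(x)|/\lambda)\,d\mathbb P\le1\}$. Uniformly lower (upper) type $p$: $\varphi(x,st)\le Cs^p\varphi(x,t)$ for all $x$, $t\ge0$, $s\in(0,1)$ (resp. $s\ge1$). For $q>1$, $\varphi\in A_q(\Omega)$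 if $\sup_{t>0}\mathbb E_n(\varphi(\cdot,t))[\mathbb E_n(\varphi(\cdot,t)^{-1/(q-1)})]^{q-1}\le K$ a.e. for all $n$; $\varphi\in A_1(\Omega)$ if $\sup_{t>0}\mathbb E_n(\varphi(\cdot,t))/\varphi(\cdot,t)\le K$ a.e.; $A_\infty(\Omega)=\bigcup_{q\ge1}A_q(\Omega)$; $q(\varphi):=\inf\{q\ge1:\varphi\in A_q(\Omega)\}$. *)

(* Defs.v *)
From HB Require Import structures.
From mathcomp Require Import all_boot all_order all_algebra.
From mathcomp Require Import all_classical all_reals all_analysis.
From mathcomp Require Import measurable_realfun.
Set Implicit Arguments. Unset Strict Implicit. Unset Printing Implicit Defensive.
Import Order.TTheory GRing.Theory Num.Theory.
Import numFieldNormedType.Exports.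
Local Open Scope classical_set_scope.
Local Open Scope ring_scope.

Section Defs.
Context {d : measure_display} {T : measurableType d} {R : realType}.
Variable P : probability T R.

Definition Gmeasurable (G : set (set T)) (g : T -> \bar R) : Prop :=
  forall B : set (\bar R), measurable B -> G (g @^-1` B).

Definition filtration (F : nat -> set (set T)) : Prop :=
  (forall n, sigma_algebra setT (F n)) /\
  (forall n, F n `<=` measurable) /\
  (forall n m, (n <= m)%N -> F n `<=` F m).

Definition cexp_nonneg (G : set (set T)) (h g : T -> \bar R) : Prop :=
  (forall x, (0 <= g x)%E) /\ Gmeasurable G g /\
  forall A, G A -> (\int[P]_(x in A) g x = \int[P]_(x in A) h x)%E.

Definition cexp (G : set (set T)) (f g : T -> R) : Prop :=
  Gmeasurable G (EFin \o g) /\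
  exists u v : T -> \bar R,
    cexp_nonneg G (fun x => (Num.max (f x) 0)%:E) u /\
    cexp_nonneg G (fun x => (Num.max (- f x) 0)%:E) v /\
    {ae P, forall x, u x \is a fin_num /\ v x \is a fin_num /\
                     (g x)%:E = (u x - v x)%E}.

Definition MOfun (phi : T -> R -> R) : Prop :=
  (forall x, {in `[0, +oo[ &, {homo phi x : s t / s <= t}}) /\
  (forall x, phi x 0 = 0) /\
  (forall x t, 0 <= t -> 0 <= phi x t) /\
  (forall x, phi x @ +oo --> +oo) /\
  (forall t, 0 <= t -> measurable_fun setT (phi ^~ t)) /\
  (forall t, 0 < t -> forall x, 0 < phi x t) /\
  (forall t, 0 <= t -> P.-integrable setT (EFin \o phi ^~ t)).

Definition lower_type (phi : T -> R -> R) (p : R) : Prop :=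
  exists C : R, 0 < C /\ forall x t s, 0 <= t -> 0 < s < 1 ->
    phi x (s * t) <= C * s `^ p * phi x t.

Definition upper_type (phi : T -> R -> R) (p : R) : Prop :=
  exists C : R, 0 < C /\ forall x t s, 0 <= t -> 1 <= s ->
    phi x (s * t) <= C * s `^ p * phi x t.

Definition Aq_gt1 (F : nat -> set (set T)) (q : R) (phi : T -> R -> R) : Prop :=
  exists K : R, forall n t, 0 < t ->
    exists u v : T -> \bar R,
      cexp_nonneg (F n) (fun x => (phi x t)%:E) u /\
      cexp_nonneg (F n) (fun x => ((phi x t) `^ (- (q - 1)^-1))%:E) v /\
      {ae P, forall x, (u x * poweR (v x) (q - 1) <= K%:E)%E}.

Definition A1 (F : nat -> set (set T)) (phi : T -> R -> R) : Prop :=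
  exists K : R, forall n t, 0 < t ->
    exists u : T -> \bar R,
      cexp_nonneg (F n) (fun x => (phi x t)%:E) u /\
      {ae P, forall x, (u x <= (K * phi x t)%:E)%E}.

Definition Aq (F : nat -> set (set T)) (q : R) (phi : T -> R -> R) : Prop :=
  (q = 1 /\ A1 F phi) \/ (1 < q /\ Aq_gt1 F q phi).

Definition Ainfty (F : nat -> set (set T)) (phi : T -> R -> R) : Prop :=
  exists q, 1 <= q /\ Aq F q phi.

Definition critical_q (F : nat -> set (set T)) (phi : T -> R -> R) : \bar R :=
  ereal_inf [set q%:E | q in [set q : R | 1 <= q /\ Aq F q phi]].

Definition phiE (phi : T -> R -> R) (x : T) (a : \bar R) : \bar R :=
  match a with
  | a'%:E => (phi x a')%:E
  | +oo%E => +oo%E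
  | -oo%E => 0%E
  end.

Definition MOnorm (phi : T -> R -> R) (g : T -> \bar R) : \bar R :=
  ereal_inf [set l%:E | l in [set l : R | 0 < l /\
     (\int[P]_x phiE phi x (g x * (l^-1)%:E) <= 1)%E]].

(* maximal function M(f) = sup_n |E_n f| built from versions E n of E_n f *)
Definition maxfun (E : nat -> T -> R) (x : T) : \bar R :=
  ereal_sup (range (fun n => (`| E n x |)%:E)).

End Defs.

(* Main.v *)
(** Fix [q < p^-] with [phi] in [A_q].  For finitely many [f_j] and times, put
    [g = (\sum_j |f_j|^r)^(1/r)] and [G = (\sum_j (M f_j)^r)^(1/r)].  A good-lambda
    inequality compares [G] with the scalar maximal function [M g]: unweighted
    Marcinkiewicz interpolation relative to [g] shows that, after [G] first exceeds
    a level, it overshoots with conditional probability at most 1/2 as long as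
    [M g] stays small, and [A_q] turns this into the loss of a fixed proportion of
    [phi(.,t)]-mass.  Iterating over many small steps of the level makes the
    good-lambda factor small enough to be absorbed when summing over dyadic [t],
    so that the modular of [G] is controlled by that of [M g].  The latter is
    controlled by the modular of [g] through the weak type (q, q) inequality with
    weight [phi(.,t)], summed over dyadic [t] thanks to [q < p^-]. *)
Require Import Defs.
From HB Require Import structures.
From mathcomp Require Import all_boot all_order all_algebra.
From mathcomp Require Import all_classical all_reals all_analysis.
From mathcomp Require Import measurable_realfun.
From mathcomp Require Import zify ring lra.
Set Implicit Arguments. Unset Strict Implicit. Unset Printing Implicit Defensive.
Import Order.TTheory GRing.Theory Num.Theory.
Import numFieldNormedType.Exports.
Local Open Scope classical_set_scope.
Local Open Scope ring_scope.

(** The function [x |-> phi x (G x)] may fail to be measurable, and this dictates the form of the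
    estimates: only weights [phi ^~ t] with [t] fixed are integrated against level sets, and the
    modular of [G] is reached at the end through a measurable majorant, the sum of [phi x t] over
    the dyadic [t] below [G x]. Finitely many functions and times keep the maximal functions real
    valued; the constants do not depend on these numbers, nor on the range of dyadic levels, so
    monotone limits remove the truncation. The absorption leaves one boundary term at the lowest
    level, which is small because [phi ^~ T0] is integrable and [phi x (T0 / 2^n)] decays by the
    lower type. Stopping times appear only as disjoint first-hitting sets, on which integrals over
    sets of [F n] are compared; conditional probabilities are thus never manipulated as functions. A
    modular bound by a constant becomes a norm bound because [pm > q >= 1]: dividing the argument by
    a large constant divides [phi] by at least a multiple of that constant. *)

Section LowerIntegral.
Context d (T : measurableType d) (R : realType) (P : {measure set T -> \bar R}).

(** No measurability is assumed: [phi x (g x)] need not be measurable in [x], as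
    [phi x] is only nondecreasing; the library integral of a nonnegative function
    is then its lower integral. *)
Lemma le_lower_integral (f g : T -> \bar R) :
  (forall x, 0 <= f x)%E -> (forall x, f x <= g x)%E ->
  (\int[P]_x f x <= \int[P]_x g x)%E.
Proof.
move=> f0 fg; have g0 x : (0 <= g x)%E by exact: le_trans (fg x).
rewrite !ge0_integralTE//; apply: ereal_sup_le => _ [h hf <-].
by exists h => // x; exact: le_trans (fg x).
Qed.

End LowerIntegral.

(** * Conditional expectations of nonnegative functions *)

Section CondExp.
Context d (T : measurableType d) (R : realType) (P : probability T R).
Variables (G : set (set T)) (sG : sigma_algebra setT G)
  (Gm : G `<=` measurable).

Local Notation TG := (g_sigma_algebraType G).

Lemma sub_measurableE (A : set T) : @measurable _ TG A = G A.
Proof. by rewrite /measurable/= (sigma_algebra_id sG). Qed.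

Lemma measurable_fun_subid : measurable_fun [set: T] (idfun : T -> TG).
Proof. by move=> _ A; rewrite sub_measurableE setTI => /Gm. Qed.

Lemma sub_measurable_funS d' (T' : measurableType d') (h : T -> T') :
  measurable_fun [set: TG] h -> measurable_fun [set: T] h.
Proof.
move=> mh _ B mB; rewrite setTI; apply: Gm.
by rewrite -sub_measurableE -[X in measurable X]setTI; exact: mh.
Qed.

Lemma GmeasurableE (g : T -> \bar R) :
  Gmeasurable G g <-> measurable_fun [set: TG] g.
Proof.
split=> mg.
  by move=> _ B mB; rewrite setTI sub_measurableE; exact: mg.
by move=> B mB; rewrite -sub_measurableE -[X in measurable X]setTI; exact: mg.
Qed.

(** The identity seen as a measurable map onto the coarser space; its [distribution] is the
    restriction of [P] to [G]. *)
HB.instance Definition _ := @isMeasurableFun.Build _ _ T TG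
  (idfun : T -> TG) measurable_fun_subid.

Definition sub_density (h : T -> R) (A : set TG) : \bar R :=
  (\int[P]_(x in A) (h x)%:E)%E.

Section density.
Variable h : T -> R.
Hypotheses (mh : measurable_fun setT h) (h0 : forall x, 0 <= h x).
Variable M : R.
Hypothesis hM : forall x, h x <= M.

Let nu0 : sub_density h set0 = 0%E.
Proof. by rewrite /sub_density integral_set0. Qed.

Let nu_ge0 A : (0 <= sub_density h A)%E.
Proof. by apply: integral_ge0 => x _; rewrite lee_fin. Qed.

Let mEh : measurable_fun [set: T] (EFin \o h).
Proof. exact/measurable_EFinP. Qed.

Let nu_sigma_additive : semi_sigma_additive (sub_density h).
Proof.
move=> A mA tA mUA.
have GT B : @measurable _ TG B -> d.-measurable B.
  by rewrite sub_measurableE => /Gm.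
have Eh0 x : (0 <= (EFin \o h) x)%E by rewrite lee_fin.
exact: (@semi_sigma_additive_nng_induced _ _ _ P _ mEh Eh0 _ (fun i => GT _ (mA i)) tA (GT _ mUA)).
Qed.

Let nu_meas : {measure set TG -> \bar R} := HB.pack (sub_density h)
  (isMeasure.Build _ _ _ (sub_density h) nu0 nu_ge0 nu_sigma_additive).

Let nu_fin : fin_num_fun nu_meas.
Proof.
move=> A mA; rewrite ge0_fin_numE//.
have {}mA : d.-measurable A by apply: Gm; rewrite -sub_measurableE.
apply: (@le_lt_trans _ _ (\int[P]_(x in A) (cst M%:E) x)%E).
  apply: ge0_le_integral => //=; [|exact: measurable_funTS|].
  - by move=> x _; rewrite lee_fin.
  - by move=> x _; rewrite lee_fin.
by rewrite integral_cst// ltey_eq fin_numM// fin_num_measure.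
Qed.

Let nu_finmeas : {finite_measure set TG -> \bar R} := HB.pack (Measure.sort nu_meas)
  (@Measure_isFinite.Build _ _ _ nu_meas nu_fin).

(** Radon-Nikodym derivative of [A |-> \int_A h] with respect to [P], both restricted to [G]. The
    bound on [h] makes the first measure finite. *)
Lemma cexp_nonneg_bounded : exists g, cexp_nonneg P G (EFin \o h) g.
Proof.
pose X : {mfun T >-> TG} := idfun.
pose mu := distribution P X.
have numu : nu_finmeas `<< mu.
  apply/null_content_dominatesP => A mA muA.
  change (\int[P]_(x in A) (h x)%:E = 0)%E.
  have mTA : d.-measurable A by apply: Gm; rewrite -sub_measurableE.
  by apply: null_set_integral => //; exact: measurable_funTS.
have [g [g0 gfin gint gE]] := radon_nikodym_sigma_finite numu.
exists g; split=> //; split.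
  by apply/GmeasurableE; exact: measurable_int gint.
move=> A GA; have mA : @measurable _ TG A by rewrite sub_measurableE.
transitivity (nu_finmeas A) => //; rewrite gE// ge0_integral_pushforward//.
apply: measurable_funTS; exact: measurable_int gint.
Qed.

End density.

(** Cutting [h] into the bounded slices [n <= h < n + 1] and adding their conditional expectations
    requires no integrability; the sum may take the value [+oo]. *)
Lemma cexp_nonneg_ex (h : T -> R) : measurable_fun setT h ->
  (forall x, 0 <= h x) -> exists g, cexp_nonneg P G (EFin \o h) g.
Proof.
move=> mh h0; pose slice n := [set x | n%:R <= h x < n.+1%:R].
have mslice n : d.-measurable (slice n).
  rewrite (_ : slice n = h @^-1` `[n%:R, n.+1%:R[%classic).
    by rewrite -[X in measurable X]setTI; exact: mh.
  by apply/seteqP; split => x /=; rewrite in_itv.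
pose hn n x := h x * \1_(slice n) x.
have mhn n : measurable_fun setT (hn n).
  by apply: measurable_funM => //; exact: measurable_indic.
have hn0 n x : 0 <= hn n x by rewrite mulr_ge0.
have hnM n x : hn n x <= n.+1%:R.
  rewrite /hn indicE; have [|_] := boolP (x \in _); last by rewrite mulr0.
  by rewrite inE mulr1 => /andP[_ /ltW].
have hE x : ((h x)%:E = \sum_(n <oo) (hn n x)%:E)%E.
  pose k := Num.truncn (h x).
  have kx : k%:R <= h x < k.+1%:R by exact: truncn_itv.
  rewrite (@nneseriesD1 _ _ k)//=; last by move=> n _; rewrite lee_fin.
  rewrite eseries0 ?adde0.
    by rewrite /hn indicE mem_set ?mulr1.
  move=> n _ /eqP nk; rewrite /hn indicE memNset ?mulr0// => /truncn_def kn.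
  exact/nk/esym.
have /choice[gn gnP] n := cexp_nonneg_bounded (mhn n) (hn0 n) (hnM n).
have gn0 n x : (0 <= gn n x)%E by have [+ _] := gnP n; exact.
have mgn n : measurable_fun [set: TG] (gn n).
  by apply/GmeasurableE; have [_ []] := gnP n.
exists (fun x => \sum_(n <oo) gn n x)%E; split.
  by move=> x; exact: nneseries_ge0.
split.
  by apply/GmeasurableE; exact: ge0_emeasurable_sum.
move=> A GA; have mA := Gm GA.
rewrite integral_nneseries//; last first.
  by move=> n; apply: measurable_funTS; exact: sub_measurable_funS.
under [RHS]eq_integral do rewrite /= hE.
rewrite integral_nneseries//.
- by apply: eq_eseriesr => n _; have [_ [_]] := gnP n; exact.
- by move=> n; apply: measurable_funTS; exact/measurable_EFinP.
- by move=> n x _; rewrite lee_fin.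
Qed.

End CondExp.

(** * From [A_q] to the integrated Muckenhoupt inequality *)

Lemma countable_doubling_cover (R : realType) : exists c : nat -> R,
  (forall n, 0 < c n) /\ (forall x, 0 < x -> exists n, c n <= x < 2 * c n).
Proof.
pose c n : R := let p := odflt (0, 0)%N (unpickle n) in p.1.+1%:R / p.2.+1%:R.
exists c; split=> [n|x x0]; first by rewrite /c divr_gt0.
(* Since b + 1 > 1/x, the product y = x (b + 1) is at least 1; its integer part a satisfies a <= y <
   a + 1 <= 2 a, so a / (b + 1) is the wanted positive rational. *)
pose b := Num.truncn x^-1; pose y := x * b.+1%:R.
have y1 : 1 <= y.
  rewrite /y -ler_pdivrMl// mulr1 ltW//.
  have xV0 : 0 <= x^-1 by rewrite invr_ge0 ltW.
  by have /andP[] := truncn_itv xV0.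
have /andP[ay ya] := truncn_itv (le_trans ler01 y1).
have a0 : (0 < Num.truncn y)%N by rewrite truncn_gt0.
exists (pickle ((Num.truncn y).-1, b)); rewrite /c pickleK/= prednK//.
rewrite ler_pdivrMr// -/y ay/= mulrA ltr_pdivlMr// -/y.
by rewrite (lt_le_trans ya)// -natr1 mulr_natl mulr2n lerD2l ler1n.
Qed.

Section Muckenhoupt.
Context d (T : measurableType d) (R : realType) (P : probability T R).

(** Integrated form of [(E_n h)^q E_n w <= K E_n(h^q w)], covering [q = 1] and
    [q > 1] at once; this is the only consequence of [A_q] that is needed. *)
Definition muckenhoupt (F : nat -> set (set T)) (w : T -> R) (q K : R) :=
  forall n (A : set T) (h : T -> R) (l : R), F n A ->
    measurable_fun setT h -> (forall x, 0 <= h x) -> 0 < l ->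
    (forall B, F n B -> B `<=` A -> l%:E * P B <= \int[P]_(x in B) (h x)%:E)%E ->
    ((l `^ q)%:E * \int[P]_(x in A) (w x)%:E <=
      K%:E * \int[P]_(x in A) (h x `^ q * w x)%:E)%E.

End Muckenhoupt.

Section MuckenhouptOfAq.
Context d (T : measurableType d) (R : realType) (P : probability T R).
Variables (G : set (set T)) (sG : sigma_algebra setT G)
  (Gm : G `<=` measurable).
Variables (w : T -> R) (q K : R).
Hypotheses (mw : measurable_fun setT w) (w0 : forall x, 0 < w x)
  (iw : P.-integrable setT (EFin \o w)) (K0 : 0 < K).

(** Cutting along the sets [{c <= u < 2c}], where the version [u] of [E(w|G)] is
    constant up to a factor 2, avoids pulling [G]-measurable functions out of
    conditional expectations. *)
Lemma doubling_sublevel_bound (u : T -> \bar R) (h : T -> R) (A : set T) (l : R) :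
  cexp_nonneg P G (EFin \o w) u ->
  measurable_fun setT h -> (forall x, 0 <= h x) -> G A -> 0 < l ->
  (forall (c : R) B, 0 < c -> G B -> B `<=` A ->
     B `<=` [set x | c%:E <= u x < (2 * c)%:E]%E ->
     ((l `^ q * c)%:E * P B <= K%:E * \int[P]_(x in B) (h x `^ q * w x)%:E)%E) ->
  ((l `^ q)%:E * \int[P]_(x in A) (w x)%:E <=
      (2 * K)%:E * \int[P]_(x in A) (h x `^ q * w x)%:E)%E.
Proof.
move=> [u0 [mu uE]] mh h0 GA l0 loc.
have [c [c0 ccov]] := countable_doubling_cover R.
pose S n := A `&` [set x | (c n)%:E <= u x < (2 * c n)%:E]%E.
pose B := seqDU S.
have GI X Y : G X -> G Y -> G (X `&` Y).
  by rewrite -!(sub_measurableE sG); exact: measurableI.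
have GS n : G (S n).
  apply: GI => //; rewrite (_ : [set x | _] = u @^-1` `[(c n)%:E, (2 * c n)%:E[%classic).
    by apply: mu; exact: emeasurable_itv.
  by apply/seteqP; split => x /=; rewrite in_itv.
have GB n : G (B n).
  have := GS; rewrite -(sub_measurableE sG) => {}GS.
  by apply: seqDU_measurable => i; rewrite (sub_measurableE sG).
have BA n : B n `<=` A.
  by apply: subset_trans (@subset_seqDU _ S n) _; exact: subIsetl.
have Bc n : B n `<=` [set x | (c n)%:E <= u x < (2 * c n)%:E]%E.
  by apply: subset_trans (@subset_seqDU _ S n) _; exact: subIsetr.
pose U := \bigcup_n B n.
have GU : G U.
  have := GB; rewrite -(sub_measurableE sG) => {}GB.
  by apply: bigcup_measurable => i _; rewrite (sub_measurableE sG).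
have GZ : G (A `\` U).
  by rewrite -(sub_measurableE sG); apply: measurableD; rewrite (sub_measurableE sG).
have UA : U `<=` A by move=> x [n _ /BA].
have mA := Gm GA; have mU := Gm GU; have mZ := Gm GZ.
have mhw : measurable_fun setT (fun x => (h x `^ q * w x)%:E).
  apply/measurable_EFinP/measurable_funM => //.
  exact: (measurableT_comp (measurable_powR q)).
have hw0 x : (0 <= (h x `^ q * w x)%:E)%E.
  by rewrite lee_fin mulr_ge0 ?powR_ge0// ltW.
have mEw : measurable_fun setT (EFin \o w) by exact/measurable_EFinP.
have w0' x : (0 <= (EFin \o w) x)%E by rewrite lee_fin ltW.
have mu' : measurable_fun setT u.
  by apply: (sub_measurable_funS sG Gm); exact/(GmeasurableE sG).
have iu : P.-integrable setT u.
  apply/integrableP; split=> //.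
  under eq_integral do rewrite gee0_abs//.
  have GT : G setT by rewrite -(sub_measurableE sG); exact: measurableT.
  rewrite uE//; have /integrableP[_] := iw.
  by under eq_integral do rewrite gee0_abs//.
(* Outside all slices [u] is 0 or [+oo]. The value [+oo] occurs on a null set because [w] is
   integrable, and [u] and [w] have the same integral over this set of [G]. *)
have Z0 : (\int[P]_(x in A `\` U) (w x)%:E = 0)%E.
  rewrite -[LHS]uE//; transitivity (\int[P]_(x in A `\` U) (cst 0 x))%E.
    apply: ge0_ae_eq_integral => //; first exact: measurable_funTS.
    have := integrable_ae measurableT iu; apply: filterS => x /(_ Logic.I) ufin.
    move=> [Ax /= nU].
    have := u0 x; rewrite le_eqVlt => /orP[/eqP<-//|ux].
    exfalso; apply: nU; rewrite /U -seqDU_bigcup_eq.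
    have fu0 : 0 < fine (u x) by rewrite fine_gt0// ux ltey_eq ufin.
    have [n cn] := ccov _ fu0.
    exists n => //; split=> //=.
    by rewrite -(fineK ufin) !(lee_fin,lte_fin).
  by rewrite integral0.
have AE : A = (A `\` U) `|` U by rewrite setUC setDUK.
have -> : (\int[P]_(x in A) (w x)%:E = \sum_(n <oo) \int[P]_(x in B n) (w x)%:E)%E.
  rewrite {1}AE ge0_integral_setU//=.
  - rewrite Z0 add0e ge0_integral_bigcup//; [by move=> k; exact: Gm| | |].
    + exact: measurable_funTS.
    + by move=> x _; exact: w0'.
    + exact: trivIset_seqDU.
  - exact: measurable_funTS.
  - by move=> x _; exact: w0'.
  - by rewrite disj_set2E setDKI.
have lq : 0 < l `^ q by exact: powR_gt0.
rewrite -nneseriesZl//; last by move=> n _; apply: integral_ge0 => x _; exact: w0'.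
apply: (@le_trans _ _ (\sum_(n <oo) (2 * K)%:E * \int[P]_(x in B n) (h x `^ q * w x)%:E)%E).
  apply: lee_nneseries => [n _ _|n _].
    by apply: mule_ge0; [rewrite lee_fin ltW|apply: integral_ge0 => x _; exact: w0'].
  have := loc (c n) (B n) (c0 n) (GB n).
  move=> /(_ (BA n) (Bc n)) locn.
  rewrite EFinM -muleA; apply: le_trans (lee_wpmul2l _ locn); last by rewrite lee_fin.
  rewrite muleA -EFinM mulrCA EFinM -muleA.
  apply: lee_wpmul2l; first by rewrite lee_fin ltW.
  (* The [w]-mass of a slice is the integral of [u], at most [2 * c n] times its probability: this
     is the factor 2 of the conclusion. *)
  rewrite -[leLHS]uE//.
  have mB := Gm (GB n).
  apply: (@le_trans _ _ (\int[P]_(x in B n) (cst (2 * c n)%:E x))%E).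
    apply: ge0_le_integral => //; first exact: measurable_funTS.
    by move=> x /Bc /andP[_ /ltW].
  by rewrite integral_cst.
rewrite nneseriesZl//; last by move=> n _; apply: integral_ge0 => x _; exact: hw0.
apply: lee_wpmul2l; first by rewrite lee_fin mulr_ge0// ltW.
rewrite -ge0_integral_bigcup//.
- by apply: ge0_subset_integral => //; exact: measurable_funTS.
- by move=> k; exact: Gm.
- exact: measurable_funTS.
- exact: trivIset_seqDU.
Qed.
End MuckenhouptOfAq.

(** Where [h] exceeds [a], one factor [h] is h^q / h^(q-1), and the denominator only decreases when
    [h] is replaced by [a]. This stands in for Young's inequality. *)
Lemma ler_add_powR_div (R : realType) (q a h : R) : 1 <= q -> 0 < a -> 0 <= h ->
  h <= a + h `^ q / a `^ (q - 1).
Proof.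
move=> q1 a0 h0; have q0 : 0 < q by exact: lt_le_trans q1.
have aq : 0 < a `^ (q - 1) by exact: powR_gt0.
have [ha|ah] := leP h a; first by rewrite ler_wpDr// divr_ge0// powR_ge0.
apply: ler_wpDl; first exact: ltW.
rewrite ler_pdivlMr// -(mulr_powRB1 h0 q0) ler_wpM2l//.
by rewrite ge0_ler_powR ?subr_ge0// ?nnegrE ?ltW.
Qed.

Section MuckenhouptLocal.
Context d (T : measurableType d) (R : realType) (P : probability T R).
Variables (w h : T -> R) (u : T -> \bar R) (q K c l : R) (B : set T).
Hypotheses (mB : measurable B) (mw : measurable_fun setT w)
  (w0 : forall x, 0 < w x) (mh : measurable_fun setT h)
  (h0 : forall x, 0 <= h x) (K0 : 0 < K) (c0 : 0 < c) (l0 : 0 < l)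
  (Bu : forall x, B x -> (c%:E <= u x)%E)
  (Bh : (l%:E * P B <= \int[P]_(x in B) (h x)%:E)%E).

(** [v] is bounded by the constant [V] on [B], so Hoelder's inequality reduces to
    [ler_add_powR_div] with [a] proportional to [w^(-1/(q-1))]. *)
Lemma muckenhoupt_local_gt1 (v : T -> \bar R) : 1 < q ->
  measurable_fun setT v -> (forall x, 0 <= v x)%E ->
  (\int[P]_(x in B) v x = \int[P]_(x in B) (w x `^ (- (q - 1)^-1))%:E)%E ->
  {ae P, forall x, (u x * poweR (v x) (q - 1) <= K%:E)%E} ->
  ((l `^ q * c)%:E * P B <=
    (2 `^ q * K)%:E * \int[P]_(x in B) (h x `^ q * w x)%:E)%E.
Proof.
move=> q1 mv v0 vE uv.
have q10 : 0 < q - 1 by rewrite subr_gt0.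
have q0 : 0 < q by exact: lt_trans q1.
have Kc0 : 0 < K / c by exact: divr_gt0.
pose V := (K / c) `^ (q - 1)^-1.
have V0 : 0 < V by exact: powR_gt0.
have VE : V `^ (q - 1) = K / c.
  by rewrite /V -powRrM mulVf ?gt_eqF// powRr1// ltW.
have vV : (\int[P]_(x in B) v x <= V%:E * P B)%E.
  rewrite -integral_cst//; apply: ae_ge0_le_integral => //.
  - exact: measurable_funTS.
  - by move=> x _ /=; rewrite lee_fin ltW.
  move: uv; apply: filterS => x uvK Bx /=.
  have {uvK} : (c%:E * poweR (v x) (q - 1) <= K%:E)%E.
    by apply: le_trans uvK; apply: lee_wpmul2r; [exact: poweR_ge0|exact: Bu].
  have := v0 x; case: (v x) => [r r0| |//].
    rewrite poweR_EFin -EFinM !lee_fin -ler_pdivlMl// mulrC => rV.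
    have -> : r = (r `^ (q - 1)) `^ (q - 1)^-1.
      by rewrite -powRrM mulfV ?gt_eqF// powRr1.
    by apply: ge0_ler_powR; rewrite // ?nnegrE ?invr_ge0 ?powR_ge0 ?ltW.
  by rewrite poweRyr ?gt_eqF// gt0_muley.
have mhw : measurable_fun setT (fun x => h x `^ q * w x).
  by apply: measurable_funM => //; exact: (measurableT_comp (measurable_powR q)).
have hw0 x : 0 <= h x `^ q * w x by rewrite mulr_ge0 ?powR_ge0// ltW.
set X := (\int[P]_(x in B) (h x `^ q * w x)%:E)%E.
have X0 : (0 <= X)%E by apply: integral_ge0 => x _; rewrite lee_fin.
(* With this choice [m * V] is [l / 2], so the first term of [key] is absorbed by half of its
   left-hand side. *)
pose m := l / (2 * V).
have m0 : 0 < m by rewrite divr_gt0 ?mulr_gt0.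
have mq0 : 0 < m `^ (q - 1) by exact: powR_gt0.
have mwq : measurable_fun B (fun x => (w x `^ (- (q - 1)^-1))%:E).
  apply/measurable_EFinP/measurable_funTS.
  exact: (measurableT_comp (measurable_powR _)).
have mhwB : measurable_fun B (fun x => (h x `^ q * w x)%:E).
  exact/measurable_EFinP/measurable_funTS.
have key : (l%:E * P B <= (m * V)%:E * P B + ((m `^ (q - 1))^-1)%:E * X)%E.
  apply: (le_trans Bh).
  apply: (@le_trans _ _ (\int[P]_(x in B) (m%:E * (w x `^ (- (q - 1)^-1))%:E +
      ((m `^ (q - 1))^-1)%:E * (h x `^ q * w x)%:E))%E).
    apply: ge0_le_integral => //.
    - by move=> x _; rewrite lee_fin.
    - exact/measurable_EFinP/measurable_funTS.
    - by apply: emeasurable_funD; exact: measurable_funeM.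
    move=> x _; rewrite -!EFinM -EFinD lee_fin.
    have a0 : 0 < m * w x `^ (- (q - 1)^-1) by rewrite mulr_gt0 ?powR_gt0.
    apply: le_trans (ler_add_powR_div (ltW q1) a0 (h0 x)) _.
    rewrite lerD2l powRM ?powR_ge0 ?(ltW m0)// -powRrM mulNr mulVf ?gt_eqF//.
    by rewrite powR_inv1 ?(ltW (w0 x))// invfM invrK mulrCA.
  rewrite ge0_integralD//; last 4 first.
  - by move=> x _; rewrite -EFinM lee_fin mulr_ge0 ?powR_ge0// ltW.
  - exact: measurable_funeM.
  - by move=> x _; rewrite -EFinM lee_fin; apply: mulr_ge0 => //; rewrite invr_ge0 ltW.
  - exact: measurable_funeM.
  rewrite !ge0_integralZl_EFin//; last 4 first.
  - by move=> x _; rewrite lee_fin.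
  - by rewrite invr_ge0 ltW.
  - by move=> x _; rewrite lee_fin powR_ge0.
  - exact: ltW.
  rewrite -vE (EFinM m V) -muleA; apply: leeD => //; apply: lee_wpmul2l => //.
  by rewrite lee_fin ltW.
have PBE : P B = (fine (P B))%:E by rewrite fineK// fin_num_measure.
rewrite PBE in key *; clearbody X; case: X X0 key => [X| |//] X0; last first.
  by move=> _; rewrite [leRHS]gt0_muley ?leey// lte_fin mulr_gt0 ?powR_gt0.
rewrite -!EFinM -EFinD !lee_fin; set p := fine (P B) => key.
have mV : m * V = l / 2 by rewrite /m invfM mulrA mulfVK ?gt_eqF.
have mqE : m `^ (q - 1) = (l / 2) `^ (q - 1) * (c / K).
  have VVE : V^-1 `^ (q - 1) = (V `^ (q - 1))^-1.
    by rewrite -[in LHS]powR_inv1 ?(ltW V0)// -powRrM mulN1r powRN.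
  have -> : m = l / 2 * V^-1 by rewrite /m invfM mulrA.
  rewrite (@powRM _ (l / 2) V^-1).
  - by rewrite VVE VE invf_div.
  - by apply: divr_ge0 => //; exact: ltW.
  - by rewrite invr_ge0 ltW.
have l20 : 0 < l / 2 by exact: divr_gt0.
have {}key : l / 2 * p <= (m `^ (q - 1))^-1 * X.
  by move: key; rewrite mV -lerBlDl -mulrBl {1}(splitr l) addrK.
have {}key : (l / 2) `^ q * c * p <= K * X.
  rewrite -(mulr_powRB1 (ltW l20) q0).
  rewrite ler_pdivlMl// mqE in key; apply: le_trans (ler_wpM2l (ltW K0) key).
  by rewrite le_eqVlt; apply/orP; left; apply/eqP; field; rewrite gt_eqF.
have lE : l `^ q = 2 `^ q * (l / 2) `^ q.
  by rewrite -powRM// ?(ltW l20)// mulrC divfK.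
by rewrite lE -!mulrA ler_wpM2l ?powR_ge0// !mulrA.
Qed.

(** On [B] one has [c <= u <= K * w] almost everywhere, so the constant [c] can be moved under the
    integral of [h] and replaced by [K * w]. The factor 2^q matches the bound for [q > 1]. *)
Lemma muckenhoupt_local_1 : q = 1 ->
  {ae P, forall x, (u x <= (K * w x)%:E)%E} ->
  ((l `^ q * c)%:E * P B <=
    (2 `^ q * K)%:E * \int[P]_(x in B) (h x `^ q * w x)%:E)%E.
Proof.
move=> -> uK.
have X0 : (0 <= \int[P]_(x in B) (h x * w x)%:E)%E.
  by apply: integral_ge0 => x _; rewrite lee_fin mulr_ge0// ltW.
rewrite !powRr1//; last exact: ltW.
under eq_integral do rewrite powRr1//.
apply: (@le_trans _ _ (K%:E * \int[P]_(x in B) (h x * w x)%:E)%E); last first.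
  by apply: lee_wpmul2r => //; rewrite lee_fin ler_peMl ?ler1n// ltW.
rewrite mulrC EFinM -muleA.
apply: (@le_trans _ _ (c%:E * \int[P]_(x in B) (h x)%:E)%E).
  by apply: lee_wpmul2l => //; rewrite lee_fin ltW.
have mhw : measurable_fun B (fun x => (h x * w x)%:E).
  by apply/measurable_EFinP/measurable_funTS; exact: measurable_funM.
have mhB : measurable_fun B (fun x => (h x)%:E).
  exact/measurable_EFinP/measurable_funTS.
rewrite -!ge0_integralZl_EFin//; try (by exact: ltW);
  try (by move=> x _; rewrite lee_fin mulr_ge0// ltW); last first.
  by move=> x _; rewrite lee_fin.
apply: ae_ge0_le_integral => //.
- by move=> x _; rewrite -EFinM lee_fin mulr_ge0// ltW.
- exact: measurable_funeM.
- by move=> x _; rewrite -EFinM lee_fin mulr_ge0// ?mulr_ge0// ltW.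
- exact: measurable_funeM.
move: uK; apply: filterS => x uK Bx.
rewrite -!EFinM lee_fin mulrCA mulrC ler_wpM2l//.
by rewrite -lee_fin; exact: le_trans (Bu Bx) uK.
Qed.

End MuckenhouptLocal.

(** The local bounds on slices of [u] are glued by [doubling_sublevel_bound], with one constant for
    all [n] and [t]. As the constant of [A_q] may have any sign, it is replaced by its maximum with
    1. *)
Lemma muckenhoupt_Aq d (T : measurableType d) (R : realType)
    (P : probability T R) (F : nat -> set (set T)) (phi : T -> R -> R) (q : R) :
  filtration F -> MOfun P phi -> Aq P F q phi ->
  exists2 K, 0 < K & forall t, 0 < t -> muckenhoupt P F (phi ^~ t) q K.
Proof.
move=> [sF [Fm _]] [_ [_ [_ [_ [mphi [phi0 iphi]]]]]] Aqphi.
have q1 : 1 <= q by case: Aqphi => [[->//]|[/ltW]].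
suff [K K0 HK] : exists2 K : R, 0 < K & forall n (t : R), 0 < t ->
    exists2 u, cexp_nonneg P (F n) (fun x => (phi x t)%:E) u &
    forall (B : set T) (h : T -> R) (l c : R), F n B ->
    measurable_fun setT h -> (forall x, 0 <= h x) -> 0 < l -> 0 < c ->
    (l%:E * P B <= \int[P]_(x in B) (h x)%:E)%E ->
    (forall x, B x -> c%:E <= u x)%E ->
    ((l `^ q * c)%:E * P B <=
      K%:E * \int[P]_(x in B) (h x `^ q * phi x t)%:E)%E.
  exists (2 * K) => [|t t0 n A h l FA mh h0 l0 hA]; first by rewrite mulr_gt0.
  have [u uP uK] := HK n t t0.
  apply: (doubling_sublevel_bound (sF n) (Fm n) (mphi _ (ltW t0)) (phi0 _ t0)
     (iphi _ (ltW t0)) K0 uP) => // c B c0 FB BA Bc.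
  by apply: uK => // [|x /Bc/andP[]//]; exact: hA.
case: Aqphi => [[qE [K HK]]|[q1' [K HK]]];
  have K1 : 0 < Num.max K 1 by rewrite lt_max ltr01 orbT.
all: exists (2 `^ q * Num.max K 1) => [|n t t0]; first by rewrite mulr_gt0 ?powR_gt0.
- have [u [uP uK]] := HK n t t0; exists u => // B h l c FB mh h0 l0 c0 hB Bc.
  apply: (@muckenhoupt_local_1 _ _ _ _ _ _ u) => //.
  + exact: Fm FB.
  + exact/mphi/ltW.
  + exact: phi0.
  + move: uK; apply: filterS => x /le_trans; apply.
    by rewrite lee_fin ler_wpM2r ?le_max ?lexx// ltW// phi0.
- have [u [v [uP [[v0 [mv vE]] uK]]]] := HK n t t0.
  exists u => // B h l c FB mh h0 l0 c0 hB Bc.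
  apply: (@muckenhoupt_local_gt1 _ _ _ _ _ _ u _ _ _ _ _ _ _ _ _ _ _ _ _ _ _ v) => //.
  + exact: Fm FB.
  + exact/mphi/ltW.
  + exact: phi0.
  + by apply: (sub_measurable_funS (sF n) (Fm n)); exact/(GmeasurableE (sF n)).
  + exact: vE.
  + by move: uK; apply: filterS => x /le_trans; apply; rewrite lee_fin le_max lexx.
Qed.

(** * First-hitting sets along a filtration, running maxima *)

Section Hitting.
Context d (T : measurableType d) (R : realType) (P : probability T R).

(** [seqDU Q n] is the event that [n] is the first time at which [Q] occurs; these pieces partition
    the union, so a comparison at each hitting time adds up. *)
Lemma le_integral_hitting (Q : nat -> set T) (N : nat) (f h : T -> \bar R) :
  (forall n, measurable (Q n)) ->
  measurable_fun setT f -> measurable_fun setT h ->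
  (forall x, 0 <= f x)%E -> (forall x, 0 <= h x)%E ->
  (forall n, (n < N)%N ->
    \int[P]_(x in seqDU Q n) f x <= \int[P]_(x in seqDU Q n) h x)%E ->
  (\int[P]_(x in \big[setU/set0]_(n < N) Q n) f x <=
   \int[P]_(x in \big[setU/set0]_(n < N) Q n) h x)%E.
Proof.
move=> mQ mf mh f0 h0 H; rewrite bigsetU_seqDU -!(big_mkord xpredT (seqDU Q)).
have mS := seqDU_measurable mQ.
have tS : trivIset [set` index_iota 0 N] (seqDU Q).
  by apply: sub_trivIset (trivIset_seqDU Q).
rewrite !ge0_integral_bigsetU ?iota_uniq//; try exact: measurable_funTS.
by rewrite !big_mkord; apply: lee_sum => n _; exact: H.
Qed.

Section filtered.
Variables (F : nat -> set (set T)) (FF : filtration F).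

Lemma filtration_sub n : F n `<=` measurable.
Proof. by have [_ []] := FF. Qed.

Lemma filtration_mono n m A : (n <= m)%N -> F n A -> F m A.
Proof. by have [_ [_ +]] := FF; move=> /[apply]; exact. Qed.

Lemma filtration0 n : F n set0.
Proof. by have [/(_ n) []] := FF. Qed.

Lemma filtrationI n A B : F n A -> F n B -> F n (A `&` B).
Proof.
by have [sF _] := FF; rewrite -!(sub_measurableE (sF n)); exact: measurableI.
Qed.

(** The first-hitting time is a stopping time: whether it equals [n] is decided by the events up to
    time [n]. *)
Lemma filtration_seqDU (Q : nat -> set T) n : (forall k, F k (Q k)) ->
  F n (seqDU Q n).
Proof.
have [sF _] := FF; move=> FQ; rewrite /seqDU -(sub_measurableE (sF n)).
apply: measurableD; first by rewrite (sub_measurableE (sF n)).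
apply: bigsetU_measurable => k _; rewrite (sub_measurableE (sF n)).
by apply: (@filtration_mono k) => //; exact: ltnW.
Qed.

Lemma filtration_cexp_le n h (g : T -> \bar R) a : cexp_nonneg P (F n) h g ->
  F n [set x | (g x <= a)%E].
Proof.
move=> [_ [mg _]]; rewrite (_ : mkset _ = g @^-1` `]-oo, a]%classic).
  by apply: mg; exact: emeasurable_itv.
by apply/seteqP; split => x /=; rewrite in_itv.
Qed.

Lemma filtration_cexp_gt n h (g : T -> \bar R) a : cexp_nonneg P (F n) h g ->
  F n [set x | (a < g x)%E].
Proof.
move=> gP; have [sF _] := FF; rewrite -(sub_measurableE (sF n)).
rewrite (_ : mkset _ = ~` [set x | (g x <= a)%E]).
  apply: measurableC; rewrite (sub_measurableE (sF n)).
  exact: filtration_cexp_le gP.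
by apply/seteqP; split => x /=; rewrite ltNge => /negP.
Qed.

Lemma cexp_measurable n h (g : T -> \bar R) : cexp_nonneg P (F n) h g ->
  measurable_fun setT g.
Proof.
move=> [_ [mg _]]; have [sF [Fm _]] := FF.
by apply: (sub_measurable_funS (sF n) (Fm n)); exact/(GmeasurableE (sF n)).
Qed.

End filtered.
End Hitting.

(** Maximum of [e n] over [m <= n < m + k]. *)
Fixpoint runmax (T : Type) (R : realDomainType) (e : nat -> T -> R) (m k : nat) (x : T) : R :=
  if k is k'.+1 then Num.max (runmax e m k' x) (e (m + k')%N x) else 0.

Section RunMax.
Context (T : Type) (R : realDomainType) (e : nat -> T -> R).

Lemma runmax_ge0 m k x : 0 <= runmax e m k x.
Proof. by elim: k => //= k IH; rewrite le_max IH. Qed.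

(** The sign of [t] matters because [runmax] starts from 0: a negative level is exceeded even over
    an empty window. *)
Lemma runmax_gtP m k x t : 0 <= t ->
  t < runmax e m k x <-> exists2 i, (i < k)%N & t < e (m + i)%N x.
Proof.
move=> t0; elim: k => /= [|k IH].
  by split => [/(le_lt_trans t0)|[]//]; rewrite ltxx.
rewrite lt_max; split => [/orP[/IH[i ik ti]|tk]|[i]].
- by exists i => //; exact: ltnW.
- by exists k.
rewrite ltnS leq_eqVlt => /orP[/eqP->->|ik ti]; first by rewrite orbT.
by apply/orP; left; apply/IH; exists i.
Qed.

Lemma runmax_split m k x :
  runmax e 0 (m + k) x = Num.max (runmax e 0 m x) (runmax e m k x).
Proof.
elim: k => [|k IH] /=.
  by rewrite addn0 max_l// runmax_ge0.
by rewrite addnS/= IH add0n maxA.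
Qed.

End RunMax.

Lemma measurable_runmax d (T : measurableType d) (R : realType)
    (e : nat -> T -> R) m k :
  (forall i, (i < k)%N -> measurable_fun setT (e (m + i)%N)) ->
  measurable_fun setT (runmax e m k).
Proof.
elim: k => [_|k IH me] /=; first exact: measurable_cst.
apply: measurable_maxr; last exact: me.
by apply: IH => i ik; apply: me; exact: ltnW.
Qed.

Section MeasurableSets.
Context d (T : measurableType d) (R : realType).

Lemma measurable_set_ler (f g : T -> R) : measurable_fun setT f ->
  measurable_fun setT g -> measurable [set x | f x <= g x].
Proof.
move=> mf mg; rewrite (_ : mkset _ = (fun x => f x <= g x) @^-1` [set true]).
  rewrite -[X in measurable X]setTI.
  exact: (measurable_fun_ler mf mg measurableT).
by apply/seteqP; split.
Qed.

Lemma measurable_set_ltr (f g : T -> R) : measurable_fun setT f ->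
  measurable_fun setT g -> measurable [set x | f x < g x].
Proof.
move=> mf mg; rewrite (_ : mkset _ = ~` [set x | g x <= f x]).
  exact/measurableC/measurable_set_ler.
by apply/seteqP; split => x /=; rewrite ltNge => /negP.
Qed.

(** The event that the scalar maximal function of the window [m <= n < m + k] stays below [l], when
    [D n] is a version of the conditional expectation of [g]. *)
Definition bounded_on (D : nat -> T -> \bar R) (m k : nat) (l : R) :=
  [set x | forall i, (i < k)%N -> (D (m + i)%N x <= l%:E)%E].

Lemma measurable_bounded_on (D : nat -> T -> \bar R) m k l :
  (forall n, measurable_fun setT (D n)) -> measurable (bounded_on D m k l).
Proof.
move=> mD; rewrite (_ : bounded_on _ _ _ _ =
    \bigcap_(i in [set i | (i < k)%N]) [set x | (D (m + i)%N x <= l%:E)%E]).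
  apply: bigcap_measurableType => i _.
  by rewrite -[X in measurable X]setTI; exact: emeasurable_fun_infty_c.
by apply/seteqP; split => x /= H i ik; exact: H.
Qed.

End MeasurableSets.

(** * Elementary inequalities and dyadic sums *)

Lemma le_double_of_half (R : realFieldType) (a x : R) : a <= x + a / 2 -> a <= 2 * x.
Proof. lra. Qed.

(** The largest dyadic point that counts is at most [s], and the following terms decrease with ratio
    2^(-b); neither [T] nor [I] enters the bound. *)
Lemma geometric_dyadic_sum (R : realType) (b s T : R) I : 0 < b -> 0 <= s -> 0 < T ->
  \sum_(i < I) (if T / 2 ^+ i <= s then (T / 2 ^+ i) `^ b else 0)
    <= s `^ b / (1 - (2 `^ b)^-1).
Proof.
move=> b0; have b1 : (2 `^ b)^-1 < 1.
  rewrite invf_lt1 ?powR_gt0//.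
  have : 1 `^ b < 2 `^ b by apply: gt0_ltr_powR; rewrite ?nnegrE// ltr1n.
  by rewrite powR1.
set be := (2 `^ b)^-1 in b1 *.
have c0 : 0 < 1 - be by rewrite subr_gt0.
elim: I s T => [|I IH] s T s0 T0.
  by rewrite big_ord0 divr_ge0 ?powR_ge0// ltW.
rewrite big_ord_recl /= expr0 divr1.
have shift i : T / 2 ^+ lift ord0 i = T / 2 / 2 ^+ (i : 'I_I).
  by rewrite /= /bump/= add1n exprS invfM mulrA.
under eq_bigr do rewrite shift.
have T20 : 0 < T / 2 by exact: divr_gt0.
case: ifPn => Ts; last by rewrite add0r; exact: IH.
have le2 i : T / 2 / 2 ^+ (i : 'I_I) <= T / 2.
  by rewrite ler_pdivrMr ?exprn_gt0// ler_peMr ?(ltW T20)// exprn_ege1// ler1n.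
(* All remaining points lie below [T / 2], so the threshold [s] may be lowered to [T / 2]; the
   induction hypothesis then closes the geometric series at [T] exactly. *)
rewrite (eq_bigr (fun i : 'I_I => if T / 2 / 2 ^+ i <= T / 2 then (T / 2 / 2 ^+ i) `^ b else 0));
  last first.
  move=> i _; rewrite le2 ifT// (le_trans (le2 i))// (le_trans _ Ts)//.
  by rewrite ler_pdivrMr// ler_peMr ?(ltW T0)// ler1n.
apply: le_trans (lerD (lexx _) (IH _ _ (ltW T20) T20)) _.
have -> : (T / 2) `^ b = T `^ b * be.
  rewrite powRM ?(ltW T0)// /be; congr (_ * _).
  by rewrite -[in LHS]powR_inv1// -powRrM mulN1r powRN.
have -> : T `^ b + T `^ b * be / (1 - be) = T `^ b / (1 - be).
  by field; rewrite gt_eqF.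
rewrite ler_pM2r ?invr_gt0//.
by apply: ge0_ler_powR; rewrite ?nnegrE// ltW.
Qed.

(** Discrete layer-cake bound: either [X] is below the finest level, or it lies between two
    consecutive levels and is at most twice the lower one. *)
Lemma powR_dyadic_layers (R : realType) (r X T : R) I : 0 <= r -> 0 <= X -> 0 < T -> X <= T ->
  X `^ r <= (T / 2 ^+ I) `^ r +
    \sum_(i < I) (if T / 2 ^+ i.+1 < X then 2 `^ r * (T / 2 ^+ i.+1) `^ r else 0).
Proof.
move=> r0 X0; elim: I T => [|I IH] T T0 XT.
  by rewrite big_ord0 addr0 expr0 divr1; apply: ge0_ler_powR; rewrite ?nnegrE// ltW.
rewrite big_ord_recl /= expr1; case: ifPn => TX.
  rewrite -powRM ?divr_ge0 ?(ltW T0)// mulrCA mulfV// mulr1.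
  apply: (@le_trans _ _ (T `^ r)).
    by apply: ge0_ler_powR; rewrite ?nnegrE// ltW.
  rewrite addrCA lerDl addr_ge0 ?powR_ge0//; apply: sumr_ge0 => i _.
  by case: ifP => // _; rewrite mulr_ge0 ?powR_ge0.
rewrite add0r; move: TX; rewrite -leNgt => XT2.
have T20 : 0 < T / 2 by exact: divr_gt0.
apply: le_trans (IH _ T20 XT2) _.
rewrite (exprS 2 I) invfM mulrA lerD2l; apply: ler_sum => i _.
by rewrite /bump/= add1n (exprS 2 i.+1) invfM mulrA.
Qed.

(** * Interpolation for one function, relative to [g] *)

Section VectorWeak.
Context d (T : measurableType d) (R : realType) (P : probability T R).
Variables (F : nat -> set (set T)) (FF : filtration F).
Variables (g : T -> R) (D : nat -> T -> \bar R).
Hypotheses (mg : measurable_fun setT g) (g0 : forall x, 0 <= g x)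
  (gD : forall n, cexp_nonneg P (F n) (EFin \o g) (D n)).

Let Fm n A : F n A -> measurable A.
Proof. exact: filtration_sub. Qed.

Section one_function.
Variables (f : T -> R) (e : nat -> T -> R).
Hypotheses (mf : measurable_fun setT f) (f0 : forall x, 0 <= f x)
  (fe : forall n, cexp_nonneg P (F n) (EFin \o f) (EFin \o e n)).

(** On the first-hitting set of [e n > t] inside [D n <= l], the part of [f] below
    [t / (2 l) g] has mean at most [t / 2], so only the part above matters: [g]
    plays the role of the constant in Marcinkiewicz interpolation. *)
Lemma relative_weak_bound (l t : R) m k A : 0 < l -> 0 < t -> F m A ->
  (t%:E * P (A `&` bounded_on D m k l
             `&` [set x | (t < runmax e m k x)%R])
   <= 2%:E * \int[P]_(x in A)
     (f x * \1_[set x | t * g x <= 2 * l * f x] x)%:E)%E.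
Proof.
move=> l0 t0 FA.
pose h x := f x * \1_[set x | t * g x <= 2 * l * f x] x.
have mS : measurable [set x | t * g x <= 2 * l * f x].
  by apply: measurable_set_ler; exact: measurable_funM.
have mh : measurable_fun setT (EFin \o h).
  by apply/measurable_EFinP/measurable_funM => //; exact: measurable_indic.
have h0 x : (0 <= (EFin \o h) x)%E by rewrite lee_fin mulr_ge0.
(* Hitting before time [m] is excluded, since [A] is only known to belong to [F m]. *)
pose Q n := if (m <= n)%N then
  A `&` [set x | (D n x <= l%:E)%E] `&` [set x | (t%:E < (EFin \o e n) x)%E] else set0.
have FQ n : F n (Q n).
  rewrite /Q; case: leqP => [mn|_]; last exact: filtration0.
  apply: (filtrationI FF); last exact: (filtration_cexp_gt FF _ (fe n)).
  apply: (filtrationI FF); last exact: (filtration_cexp_le _ (gD n)).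
  exact: (filtration_mono FF mn FA).
have mQ n : measurable (Q n) by exact: Fm (FQ n).
have QA n : Q n `<=` A by rewrite /Q; case: leqP => _ x; [case=> -[]|].
have mf' : measurable_fun setT (EFin \o f) by exact/measurable_EFinP.
have mg' : measurable_fun setT (EFin \o g) by exact/measurable_EFinP.
have main : (\int[P]_(x in \big[setU/set0]_(n < m + k) Q n) (cst t%:E) x <=
    \int[P]_(x in \big[setU/set0]_(n < m + k) Q n) (2%:E * (EFin \o h) x))%E.
  apply: le_integral_hitting => //.
  - exact: measurable_funeM.
  - by move=> x; rewrite lee_fin ltW.
  - by move=> x; rewrite mule_ge0.
  move=> n _; set B := seqDU Q n.
  have FB : F n B by exact: filtration_seqDU.
  have mB := Fm FB.
  have BQ : B `<=` Q n by exact: subset_seqDU.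
  have BD x : B x -> (D n x <= l%:E)%E.
    by move=> /BQ; rewrite /Q; case: leqP => _; [case=> -[]|].
  have Be x : B x -> (t%:E <= (e n x)%:E)%E.
    by move=> /BQ; rewrite /Q; case: leqP => _; [case=> _ /ltW|].
  rewrite integral_cst// ge0_integralZl_EFin//; last exact: measurable_funTS.
  change (t%:E * P B <= 2%:E * \int[P]_(x in B) (EFin \o h) x)%E.
  have Bt : (t%:E * P B <= \int[P]_(x in B) (f x)%:E)%E.
    have [_ [_ /(_ _ FB) <-]] := fe n.
    rewrite -integral_cst//; apply: ge0_le_integral => //.
    - by move=> x _; rewrite lee_fin ltW.
    - exact: measurable_funTS (cexp_measurable FF (fe n)).
  have Bg : (\int[P]_(x in B) (g x)%:E <= l%:E * P B)%E.
    have [D0 [_ /(_ _ FB) <-]] := gD n.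
    rewrite -integral_cst//; apply: ge0_le_integral => //.
    exact: measurable_funTS (cexp_measurable FF (gD n)).
  pose a := t / (2 * l).
  have a0 : 0 < a by rewrite divr_gt0 ?mulr_gt0.
  have Bf : (\int[P]_(x in B) (f x)%:E <=
      \int[P]_(x in B) (EFin \o h) x + a%:E * \int[P]_(x in B) (g x)%:E)%E.
    rewrite -ge0_integralZl_EFin//; last 3 first.
    - by move=> x _; rewrite lee_fin.
    - exact: measurable_funTS.
    - exact: ltW.
    rewrite -ge0_integralD//; last 3 first.
    - exact: measurable_funTS.
    - by move=> x _; rewrite -EFinM lee_fin mulr_ge0// ltW.
    - by apply: measurable_funeM; exact: measurable_funTS.
    apply: ge0_le_integral => //.
    - by move=> x _; rewrite lee_fin.
    - exact: measurable_funTS.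
    - apply: emeasurable_funD; first exact: measurable_funTS.
      by apply: measurable_funeM; exact: measurable_funTS.
    move=> x _; rewrite /= -EFinM -EFinD lee_fin /h indicE.
    have [_|] := boolP (x \in _); first by rewrite mulr1 lerDl mulr_ge0// ltW.
    rewrite notin_setE /= mulr0 add0r => /negP; rewrite -ltNge => /ltW fg.
    by rewrite /a mulrAC ler_pdivlMr ?mulr_gt0// mulrC.
  have PBE : P B = (fine (P B))%:E by rewrite fineK// fin_num_measure.
  have {Bt Bf Bg} : (t%:E * P B <= \int[P]_(x in B) (EFin \o h) x + a%:E * (l%:E * P B))%E.
    apply: le_trans Bt (le_trans Bf _); apply: leeD => //.
    by apply: lee_wpmul2l => //; rewrite lee_fin ltW.
  have : (0 <= \int[P]_(x in B) (EFin \o h) x)%E by apply: integral_ge0 => x _; exact: h0.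
  rewrite PBE; case: (integral _ _ _) => [X| |//] X0.
    rewrite -!EFinM -EFinD !lee_fin => H.
    have al : a * l = t / 2 by rewrite /a; field; rewrite gt_eqF.
    by apply: le_double_of_half; rewrite mulrAC -al -mulrA.
  by move=> _; rewrite [leRHS]gt0_muley ?leey// lte_fin.
have sub : A `&` bounded_on D m k l
             `&` [set x | t < runmax e m k x] `<=`
           \big[setU/set0]_(n < m + k) Q n.
  move=> x [[Ax Dx] /(runmax_gtP _ _ _ _ (ltW t0))[i ik ti]].
  rewrite -bigcup_mkord; exists (m + i)%N; first by rewrite /= ltn_add2l.
  by rewrite /Q leq_addr; split => //; split => //; exact: Dx.
have mU : measurable (\big[setU/set0]_(n < m + k) Q n) by exact: bigsetU_measurable.
apply: (@le_trans _ _ (t%:E * P (\big[setU/set0]_(n < m + k) Q n))%E).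
  apply: lee_wpmul2l; first by rewrite lee_fin ltW.
  apply: le_measure => //; rewrite inE//.
  apply: measurableI; first apply: measurableI.
  - exact: Fm FA.
  - by apply: measurable_bounded_on => n; exact: (cexp_measurable FF (gD n)).
  - apply: measurable_set_ltr => //; apply: measurable_runmax => i _.
    by apply/measurable_EFinP; exact: (cexp_measurable FF (fe (m + i)%N)).
rewrite -integral_cst//; apply: (le_trans main).
rewrite ge0_integralZl_EFin//; last exact: measurable_funTS.
apply: lee_wpmul2l => //; apply: ge0_subset_integral => //; first exact: Fm FA.
  exact: measurable_funTS.
by move=> x; rewrite -bigcup_mkord => -[n _ /QA].
Qed.

Lemma measurable_version n : measurable_fun setT (e n).
Proof. by apply/measurable_EFinP; exact: (cexp_measurable FF (fe n)). Qed.

Hypothesis fg : forall x, f x <= g x.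

(** The weak bound at level [t] gives t^r P(.) <= 2 t^(r-1) times the integral of [f] over the set
    where [t <= 2 l f / g]. Summed over dyadic [t], the powers t^(r-1) form a geometric series of
    size (2 l f / g)^(r-1), which converges because [r > 1]. The term with 2^I is what remains below
    the finest level. *)
Lemma integral_runmax_powR (r l : R) m k A I : 1 < r -> 0 < l -> F m A ->
  (\int[P]_(x in A `&` bounded_on D m k l) (runmax e m k x `^ r)%:E
   <= ((4 * l / 2 ^+ I) `^ r)%:E * P A +
      (2 * 2 `^ r * ((2 * l) `^ (r - 1) / (1 - (2 `^ (r - 1))^-1)))%:E
        * \int[P]_(x in A) (f x * (f x / g x) `^ (r - 1))%:E)%E.
Proof.
move=> r1 l0 FA; have r10 : 0 < r - 1 by rewrite subr_gt0.
have r0 : 0 < r by exact: lt_trans r1.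
have mA := Fm FA.
pose X := runmax e m k; set Q := bounded_on D m k l.
have mX : measurable_fun setT X.
  by apply: measurable_runmax => i _; exact: measurable_version.
have mQ : measurable Q.
  by apply: measurable_bounded_on => n; exact: (cexp_measurable FF (gD n)).
have mAQ : measurable (A `&` Q) by exact: measurableI.
pose T0 := 4 * l; have T00 : 0 < T0 by rewrite mulr_gt0.
pose t i := T0 / 2 ^+ i.
have t0 i : 0 < t i by rewrite divr_gt0// exprn_gt0.
pose S i := [set x | t i < X x].
have mS i : measurable (S i) by apply: measurable_set_ltr.
pose V i := [set x | t i * g x <= 2 * l * f x].
have mV i : measurable (V i) by apply: measurable_set_ler; exact: measurable_funM.
have weak i : ((t i)%:E * P (A `&` Q `&` S i) <=
    2%:E * \int[P]_(x in A) (f x * \1_(V i) x)%:E)%E.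
  exact: relative_weak_bound.
(* At the top level [4 * l] the truncation keeps only points with [2 * g <= f]; as [f <= g], [f]
   vanishes there. Hence the running maximum is almost surely at most [4 * l] on [A] and [Q], and
   the layers start there. *)
have PS0 : P (A `&` Q `&` S 0%N) = 0%E.
  have := weak 0%N; rewrite (_ : \int[P]_(x in A) _ = 0)%E; last first.
    rewrite (eq_integral (cst 0%E)) ?integral0// => x _; rewrite /= indicE.
    have [|_] := boolP (x \in _); last by rewrite mulr0.
    rewrite inE /V /t /T0 /= expr0 divr1 => fx.
    have -> : f x = 0; last by rewrite mul0r.
    have := fg x; have := f0 x => f0x fgx.
    have : 2 * l * f x <= 0.
      suff : 2 * (2 * l * f x) <= 2 * l * f x by lra.
      apply: le_trans fx; rewrite mulrA (_ : 2 * (2 * l) = 4 * l); last by ring.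
      by rewrite ler_wpM2l// ltW// mulr_gt0.
    rewrite pmulr_rle0 ?mulr_gt0// => fx0.
    by apply/eqP; rewrite eq_le fx0.
  rewrite mule0 => H; apply/eqP; rewrite eq_le measure_ge0 andbT.
  by rewrite -(@lee_pmul2l _ (t 0%N)%:E)// ?mule0// lte_fin.
have ptw x : (A `&` Q) x -> ~ (A `&` Q `&` S 0%N) x ->
    X x `^ r <= t I `^ r + \sum_(i < I) (2 `^ r * t i.+1 `^ r) * \1_(S i.+1) x.
  move=> AQx nS; have XT : X x <= T0.
    by rewrite leNgt; apply/negP => h; apply: nS; split => //; rewrite /S /t /= expr0 divr1.
  apply: le_trans (powR_dyadic_layers I (ltW r0) (runmax_ge0 e m k x) T00 XT) _.
  rewrite lerD2l; apply: ler_sum => i _; rewrite indicE.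
  have [|] := boolP (x \in _); first by rewrite inE /S /= => ->; rewrite mulr1.
  by rewrite notin_setE /S /= => /negP/negbTE ->; rewrite mulr0.
have mXr : measurable_fun setT (fun x => (X x `^ r)%:E).
  by apply/measurable_EFinP; exact: (measurableT_comp (measurable_powR r)).
have mterm i : measurable_fun setT (fun x => ((2 `^ r * t i.+1 `^ r) * \1_(S i.+1) x)%:E).
  by apply/measurable_EFinP; apply: measurable_funM => //; exact: measurable_indic.
have term0 i x : (0 <= ((2 `^ r * t i.+1 `^ r) * \1_(S i.+1) x)%:E)%E.
  by rewrite lee_fin !mulr_ge0 ?powR_ge0.
apply: (@le_trans _ _ (\int[P]_(x in A `&` Q) ((t I `^ r)%:E +
    \sum_(i < I) ((2 `^ r * t i.+1 `^ r) * \1_(S i.+1) x)%:E))%E).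
  apply: ae_ge0_le_integral => //.
  - by move=> x _; rewrite lee_fin powR_ge0.
  - exact: measurable_funTS.
  - by move=> x _; rewrite adde_ge0 ?lee_fin ?powR_ge0 ?sume_ge0.
  - apply: emeasurable_funD => //; apply: emeasurable_sum => i.
    exact: measurable_funTS.
  exists (A `&` Q `&` S 0%N); split => //; first exact: measurableI.
  move=> x /= nH; apply: contrapT => nS; apply: nH => AQx.
  by rewrite sumEFin -EFinD lee_fin; exact: ptw.
rewrite ge0_integralD//; last 3 first.
- by move=> x _; rewrite lee_fin powR_ge0.
- by move=> x _; rewrite sume_ge0.
- by apply: emeasurable_sum => i; exact: measurable_funTS.
apply: leeD.
  rewrite integral_cst//; apply: lee_wpmul2l; first by rewrite lee_fin powR_ge0.
  by apply: le_measure; rewrite ?inE//; exact: subIsetl.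
rewrite ge0_integral_sum//; last by move=> i; exact: measurable_funTS.
have mf1 i : measurable_fun setT (fun x => (f x * \1_(V i) x)%:E).
  by apply/measurable_EFinP; apply: measurable_funM => //; exact: measurable_indic.
have f10 i x : (0 <= (f x * \1_(V i) x)%:E)%E by rewrite lee_fin mulr_ge0.
apply: (@le_trans _ _ (\sum_(i < I) (2 * 2 `^ r * t i.+1 `^ (r - 1))%:E *
    \int[P]_(x in A) (f x * \1_(V i.+1) x)%:E)%E).
  apply: lee_sum => i _.
  under eq_integral do rewrite EFinM.
  rewrite ge0_integralZl_EFin//; last 2 first.
  - by apply: measurable_funTS; apply/measurable_EFinP; exact: measurable_indic.
  - by rewrite mulr_ge0 ?powR_ge0.
  rewrite integral_indic// setIC -(mulr_powRB1 (ltW (t0 i.+1)) r0).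
  rewrite (_ : 2 `^ r * _ = 2 `^ r * t i.+1 `^ (r - 1) * t i.+1); last by ring.
  rewrite (_ : 2 * 2 `^ r * _ = 2 `^ r * t i.+1 `^ (r - 1) * 2); last by ring.
  rewrite EFinM -muleA [in leRHS]EFinM -[leRHS]muleA.
  by apply: lee_wpmul2l; [rewrite lee_fin mulr_ge0 ?powR_ge0|exact: weak].
under eq_bigr => i _.
  rewrite -ge0_integralZl_EFin//; last 2 first.
  - exact: measurable_funTS.
  - by rewrite !mulr_ge0 ?powR_ge0.
  over.
rewrite -ge0_integral_sum//; last 2 first.
- by move=> i; apply: measurable_funeM; exact: measurable_funTS.
- by move=> i x _; rewrite mule_ge0// lee_fin !mulr_ge0 ?powR_ge0.
have c0 : 0 < 1 - (2 `^ (r - 1))^-1.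
  rewrite subr_gt0 invf_lt1 ?powR_gt0//.
  have : 1 `^ (r - 1) < 2 `^ (r - 1) by apply: gt0_ltr_powR; rewrite ?nnegrE// ltr1n.
  by rewrite powR1.
have mfg : measurable_fun setT (fun x => (f x * (f x / g x) `^ (r - 1))%:E).
  apply/measurable_EFinP; apply: measurable_funM => //.
  apply: (measurableT_comp (measurable_powR (r - 1))).
  rewrite (_ : (fun x => f x / g x) = (fun x => f x * g x `^ (-1))).
    by apply: measurable_funM => //; exact: (measurableT_comp (measurable_powR (-1))).
  by apply/funext => x; rewrite powR_inv1.
rewrite -ge0_integralZl_EFin//; last 3 first.
- by move=> x _; rewrite lee_fin mulr_ge0 ?powR_ge0.
- exact: measurable_funTS.
- by rewrite !mulr_ge0 ?powR_ge0 ?invr_ge0 ?ltW.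
apply: ge0_le_integral => //.
- by move=> x _; apply: sume_ge0 => i _; rewrite mule_ge0// lee_fin !mulr_ge0 ?powR_ge0.
- by apply: emeasurable_sum => i; apply: measurable_funeM; exact: measurable_funTS.
- by apply: measurable_funeM; exact: measurable_funTS.
move=> x _; under eq_bigr do rewrite -EFinM.
rewrite sumEFin -EFinM lee_fin.
have [gx0|gx0] := eqVneq (g x) 0.
  have -> : f x = 0 by apply/eqP; rewrite eq_le f0 -gx0 fg.
  by rewrite mul0r mulr0 big1// => i _; rewrite mul0r mulr0.
have {}gx0 : 0 < g x by rewrite lt_neqAle eq_sym gx0 g0.
have s0 : 0 <= 2 * l * (f x / g x) by rewrite !mulr_ge0 ?invr_ge0// ltW.
have T02 : 0 < T0 / 2 by exact: divr_gt0.
have := geometric_dyadic_sum I r10 s0 T02.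
rewrite (powRM (r - 1) (_ : 0 <= 2 * l)) ?divr_ge0 ?mulr_ge0 ?(ltW l0)// => geo.
have -> : \sum_(i < I) 2 * 2 `^ r * t i.+1 `^ (r - 1) * (f x * \1_(V i.+1) x) =
   2 * 2 `^ r * f x * \sum_(i < I) (if T0 / 2 / 2 ^+ i <= 2 * l * (f x / g x)
     then (T0 / 2 / 2 ^+ i) `^ (r - 1) else 0).
  rewrite mulr_sumr; apply: eq_bigr => i _.
  have tE : T0 / 2 / 2 ^+ i = t i.+1 by rewrite /t exprS invfM mulrA.
  rewrite tE mulrA (_ : (_ <= _) = (t i.+1 * g x <= 2 * l * f x)); last first.
    by rewrite mulrA ler_pdivlMr.
  rewrite indicE; have [|] := boolP (x \in _).
    by rewrite inE /V /= => ->; rewrite mulr1; ring.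
  by rewrite notin_setE /V /= => /negP/negbTE ->; rewrite !mulr0.
apply: le_trans (ler_wpM2l _ geo) _; first by rewrite !mulr_ge0 ?powR_ge0.
by rewrite le_eqVlt; apply/orP; left; apply/eqP; ring.
Qed.

End one_function.
End VectorWeak.

(** * Finite l^r norms and the vector-valued conditional bound *)

Definition lnorm (T : Type) (R : realType) (r : R) (J : nat) (f : nat -> T -> R) (x : T) : R :=
  (\sum_(j < J) f j x `^ r) `^ r^-1.

Section LNorm.
Context (T : Type) (R : realType) (r : R) (r1 : 1 < r) (J : nat) (f : nat -> T -> R)
  (f0 : forall j x, 0 <= f j x).

Let r0 : 0 < r. Proof. exact: lt_trans r1. Qed.

Lemma lnorm_ge0 x : 0 <= lnorm r J f x. Proof. exact: powR_ge0. Qed.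

Let sum0 x : 0 <= \sum_(j < J) f j x `^ r.
Proof. by apply: sumr_ge0 => j _; exact: powR_ge0. Qed.

Lemma lnorm_powR x : lnorm r J f x `^ r = \sum_(j < J) f j x `^ r.
Proof. by rewrite /lnorm -powRrM mulVf ?gt_eqF// powRr1. Qed.

Lemma le_lnorm (j : 'I_J) x : f j x <= lnorm r J f x.
Proof.
have -> : f j x = (f j x `^ r) `^ r^-1 by rewrite -powRrM mulfV ?gt_eqF// powRr1.
apply: ge0_ler_powR; rewrite ?nnegrE ?invr_ge0 ?powR_ge0// ?(ltW r0)//.
by rewrite (bigD1 j)//= lerDl; apply: sumr_ge0 => i _; exact: powR_ge0.
Qed.

(** Each summand is f_j^r / g^(r-1), and the f_j^r add up to g^r; if [g] vanishes so do all
    summands. This identity removes [J] from the constants. *)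
Lemma sum_lnorm x :
  \sum_(j < J) f j x * (f j x / lnorm r J f x) `^ (r - 1) = lnorm r J f x.
Proof.
set g := lnorm r J f x.
have [g0|g0] := eqVneq g 0.
  rewrite big1// => j _; have := le_lnorm j x; rewrite -/g g0 => fj.
  by have -> : f j x = 0; [apply/eqP; rewrite eq_le fj f0|rewrite mul0r].
have {}g0 : 0 < g by rewrite lt_neqAle eq_sym g0 lnorm_ge0.
have gr : 0 < g `^ (r - 1) by exact: powR_gt0.
rewrite (eq_bigr (fun j : 'I_J => f j x `^ r / g `^ (r - 1))) => [|j _].
  rewrite -mulr_suml -lnorm_powR -/g -(mulr_powRB1 (ltW g0) r0) mulfK// gt_eqF//.
rewrite powRM ?f0 ?invr_ge0 ?(ltW g0)// mulrA mulr_powRB1//; congr (_ * _).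
by rewrite -powR_inv1 ?(ltW g0)// -powRrM mulN1r powRN.
Qed.

End LNorm.

Lemma measurable_lnorm d (T : measurableType d) (R : realType) (r : R) J (f : nat -> T -> R) :
  (forall j, measurable_fun setT (f j)) -> measurable_fun setT (lnorm r J f).
Proof.
move=> mf; apply: (measurableT_comp (measurable_powR r^-1)).
by apply: measurable_sum => j; exact: (measurableT_comp (measurable_powR r)).
Qed.

(** The 1 pays for the [J] remainders below the finest dyadic level; the other term is the constant
    of [integral_runmax_powR] with the power of [l] taken out. *)
Definition weak_const (R : realType) (r : R) : R :=
  1 + 2 * 2 `^ r * (2 `^ (r - 1) / (1 - (2 `^ (r - 1))^-1)).

Lemma weak_const_gt0 (R : realType) (r : R) : 1 < r -> 0 < weak_const r.
Proof.
move=> r1; rewrite /weak_const ltr_pwDl// !mulr_ge0 ?powR_ge0// invr_ge0 subr_ge0.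
rewrite invf_le1 ?powR_gt0//.
have : 1 `^ (r - 1) <= 2 `^ (r - 1).
  by apply: ge0_ler_powR; rewrite ?nnegrE// ?subr_ge0 ?(ltW r1)// ler1n.
by rewrite powR1.
Qed.

Section VectorMaximal.
Context d (T : measurableType d) (R : realType) (P : probability T R).
Variables (F : nat -> set (set T)) (FF : filtration F) (r : R) (r1 : 1 < r) (J : nat).
Variables (f : nat -> T -> R) (e : nat -> nat -> T -> R) (D : nat -> T -> \bar R).
Hypotheses (mf : forall j, measurable_fun setT (f j)) (f0 : forall j x, 0 <= f j x)
  (fe : forall j n, cexp_nonneg P (F n) (EFin \o f j) (EFin \o e j n))
  (gD : forall n, cexp_nonneg P (F n) (EFin \o lnorm r J f) (D n)).

Let Fm n A : F n A -> measurable A.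
Proof. exact: filtration_sub. Qed.

(** With [f_j = h_j g], the bounds of [integral_runmax_powR] add up because
    [\sum_j h_j^r = 1]; this replaces a vector-valued weak (1,1) inequality. *)
Lemma integral_sum_runmax_powR (l : R) m k A : 0 < l -> F m A ->
  (forall x, A x -> D m x <= l%:E)%E ->
  (\int[P]_(x in A `&` bounded_on D m k l) (\sum_(j < J) runmax (e j) m k x `^ r)%:E
   <= (weak_const r * l `^ r)%:E * P A)%E.
Proof.
move=> l0 FA AD; have mA := Fm FA.
have mg := measurable_lnorm r J mf.
(* Large enough that J (4 / 2^I)^r <= 1, because 4 (J + 1) <= 2^I and [r >= 1]. *)
pose I := (4 * J.+1)%N.
pose c := 2 * 2 `^ r * ((2 * l) `^ (r - 1) / (1 - (2 `^ (r - 1))^-1)).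
have mB : measurable (A `&` bounded_on D m k l).
  apply: measurableI => //; apply: measurable_bounded_on => n.
  exact: (cexp_measurable FF (gD n)).
have mX j : measurable_fun setT (fun x => (runmax (e j) m k x `^ r)%:E).
  apply/measurable_EFinP; apply: (measurableT_comp (measurable_powR r)).
  apply: measurable_runmax => i _; apply/measurable_EFinP.
  exact: (cexp_measurable FF (fe j (m + i)%N)).
under eq_integral do rewrite -sumEFin.
rewrite ge0_integral_sum//; last 2 first.
- by move=> j; exact: measurable_funTS.
- by move=> j x _; rewrite lee_fin powR_ge0.
apply: (@le_trans _ _ (\sum_(j < J) (((4 * l / 2 ^+ I) `^ r)%:E * P A + c%:E *
   \int[P]_(x in A) (f j x * (f j x / lnorm r J f x) `^ (r - 1))%:E))%E).
  apply: lee_sum => j _.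
  apply: (integral_runmax_powR FF mg (lnorm_ge0 r J f) gD (mf j) (f0 j) (fe j)) => //.
  by move=> x; exact: le_lnorm.
have c0 : 0 <= c.
  rewrite !mulr_ge0 ?powR_ge0// invr_ge0 subr_ge0 invf_le1 ?powR_gt0//.
  have : 1 `^ (r - 1) <= 2 `^ (r - 1).
    by apply: ge0_ler_powR; rewrite ?nnegrE// ?subr_ge0 ?(ltW r1)// ler1n.
  by rewrite powR1.
have mh j : measurable_fun A (fun x => (f j x * (f j x / lnorm r J f x) `^ (r - 1))%:E).
  apply: measurable_funTS; apply/measurable_EFinP; apply: measurable_funM => //.
  apply: (measurableT_comp (measurable_powR (r - 1))).
  rewrite (_ : (fun x => f j x / lnorm r J f x) = (fun x => f j x * lnorm r J f x `^ (-1))).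
    by apply: measurable_funM => //; exact: (measurableT_comp (measurable_powR (-1))).
  by apply/funext => x; rewrite powR_inv1 ?lnorm_ge0.
have h0 j x : (0 <= (f j x * (f j x / lnorm r J f x) `^ (r - 1))%:E)%E.
  by rewrite lee_fin mulr_ge0 ?powR_ge0.
have Ag : (\int[P]_(x in A) (lnorm r J f x)%:E <= l%:E * P A)%E.
  have [D0 [_ /(_ _ FA) <-]] := gD m.
  rewrite -integral_cst//; apply: ge0_le_integral => //.
  exact: measurable_funTS (cexp_measurable FF (gD m)).
rewrite big_split/=.
have PAE : P A = (fine (P A))%:E by rewrite fineK// fin_num_measure.
set p := fine (P A) in PAE; have p0 : 0 <= p by exact: fine_ge0.
have S1 : (\sum_(j < J) ((4 * l / 2 ^+ I) `^ r)%:E * P A <= (l `^ r)%:E * P A)%E.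
  rewrite PAE; under eq_bigr do rewrite -EFinM.
  rewrite sumEFin sumr_const card_ord -EFinM lee_fin -(mulr_natl (_ * p)) mulrA ler_wpM2r//.
  rewrite mulrAC powRM ?divr_ge0 ?exprn_ge0 ?(ltW l0)// mulrA ler_piMl ?powR_ge0//.
  have I4 : 4 * J.+1%:R <= 2 ^+ I :> R.
    by rewrite -!natrM -natrX ler_nat ltnW// ltn_expl.
  have u1 : 4 / 2 ^+ I <= 1 :> R.
    by rewrite ler_pdivrMr// mul1r (le_trans _ I4)// ler_peMr// ler1n.
  apply: (@le_trans _ _ (J%:R * (4 / 2 ^+ I))).
    rewrite ler_wpM2l//; apply: ge1r_powR; last exact: ltW.
    by rewrite u1 divr_gt0.
  rewrite mulrA ler_pdivrMr// mul1r (le_trans _ I4)// mulrC ler_wpM2l//.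
  by rewrite ler_nat.
have S2 : (\sum_(j < J) c%:E *
    \int[P]_(x in A) (f j x * (f j x / lnorm r J f x) `^ (r - 1))%:E <= (c * l)%:E * P A)%E.
  rewrite -ge0_sume_distrr; last first.
    by move=> j _; apply: integral_ge0 => x _; exact: h0.
  rewrite -ge0_integral_sum//.
  under eq_integral do rewrite sumEFin sum_lnorm//.
  by rewrite (EFinM c l) -muleA; apply: lee_wpmul2l.
apply: le_trans (leeD S1 S2) _.
rewrite PAE -!EFinM -EFinD lee_fin -mulrDl ler_wpM2r// le_eqVlt; apply/orP; left.
apply/eqP; rewrite /weak_const /c powRM// ?(ltW l0)//.
by rewrite -(mulr_powRB1 (ltW l0) (lt_trans ltr01 r1)); ring.
Qed.

End VectorMaximal.

(** * The good-lambda inequality *)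

Lemma powR_max_le (R : realType) (r a b : R) : 0 <= r -> 0 <= a -> 0 <= b ->
  Num.max a b `^ r <= a `^ r + b `^ r.
Proof.
move=> r0 a0 b0; have [ab|ba] := leP a b.
  by rewrite lerDr powR_ge0.
by rewrite lerDl powR_ge0.
Qed.

(** This is G^r over a window of times. Without the root it is subadditive when the window is split,
    so levels of [G] enter as t^r. *)
Definition maxsum (T : Type) (R : realType) (r : R) (J : nat)
    (e : nat -> nat -> T -> R) (m k : nat) (x : T) : R :=
  \sum_(j < J) runmax (e j) m k x `^ r.

Section MaxSum.
Context (T : Type) (R : realType) (r : R) (r0 : 0 < r) (J : nat) (e : nat -> nat -> T -> R).

Lemma maxsum_ge0 m k x : 0 <= maxsum r J e m k x.
Proof. by apply: sumr_ge0 => j _; exact: powR_ge0. Qed.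

Lemma maxsum0 m x : maxsum r J e m 0 x = 0.
Proof. by rewrite /maxsum big1// => j _; rewrite /= powR0// gt_eqF. Qed.

Lemma maxsum_split m k x :
  maxsum r J e 0 (m + k) x <= maxsum r J e 0 m x + maxsum r J e m k x.
Proof.
rewrite /maxsum -big_split/=; apply: ler_sum => j _.
by rewrite runmax_split powR_max_le ?runmax_ge0 ?(ltW r0).
Qed.

Lemma maxsum_mono m k x : (m <= k)%N -> maxsum r J e 0 m x <= maxsum r J e 0 k x.
Proof.
move=> mk; rewrite -(subnKC mk); apply: ler_sum => j _.
apply: ge0_ler_powR; rewrite ?nnegrE ?runmax_ge0 ?(ltW r0)//.
by rewrite runmax_split le_max lexx.
Qed.

End MaxSum.

Lemma measurable_maxsum d (T : measurableType d) (R : realType) (r : R) J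
    (e : nat -> nat -> T -> R) m k :
  (forall j i, (i < k)%N -> measurable_fun setT (e j (m + i)%N)) ->
  measurable_fun setT (maxsum r J e m k).
Proof.
move=> me; apply: measurable_sum => j.
apply: (measurableT_comp (measurable_powR r)).
by apply: measurable_runmax => i ik; exact: me.
Qed.

Section GoodLambda.
Context d (T : measurableType d) (R : realType) (P : probability T R).
Variables (F : nat -> set (set T)) (FF : filtration F) (r : R) (r1 : 1 < r) (J N : nat).
Variables (f : nat -> T -> R) (e : nat -> nat -> T -> R) (D : nat -> T -> \bar R).
Hypotheses (mf : forall j, measurable_fun setT (f j)) (f0 : forall j x, 0 <= f j x)
  (fe : forall j n, cexp_nonneg P (F n) (EFin \o f j) (EFin \o e j n))
  (gD : forall n, cexp_nonneg P (F n) (EFin \o lnorm r J f) (D n)).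
Variables (w : T -> R) (q K : R).
Hypotheses (w0 : forall x, 0 < w x)
  (iw : P.-integrable setT (EFin \o w)) (q1 : 1 <= q) (K1 : 1 <= K)
  (wK : muckenhoupt P F w q K).

Local Notation Gam := (maxsum r J e).

Let Fm n A : F n A -> measurable A.
Proof. exact: filtration_sub. Qed.

Let mw : measurable_fun setT (EFin \o w).
Proof. exact: measurable_int iw. Qed.

Let me j n : measurable_fun setT (e j n).
Proof. by apply/measurable_EFinP; exact: (cexp_measurable FF (fe j n)). Qed.

Let mGam m k : measurable_fun setT (Gam m k).
Proof. by apply: measurable_maxsum => j i _. Qed.

Let r0 : 0 < r. Proof. exact: lt_trans ltr01 r1. Qed.

Let mD n : measurable_fun setT (D n).
Proof. exact: (cexp_measurable FF (gD n)). Qed.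

(** The window of length [n.+1] covers the times 0 to [n], all of them known at time [n]. *)
Lemma filtration_maxsum_gt n a : F n [set x | a < Gam 0 n.+1 x].
Proof.
have [sF [_ FM]] := FF; rewrite -(sub_measurableE (sF n)).
apply: measurable_set_ltr; first exact: measurable_cst.
apply: measurable_maxsum => j i; rewrite ltnS => le_in; rewrite add0n.
apply/measurable_EFinP/(GmeasurableE (sF n)) => B mB.
by have [_ [+ _]] := fe j i; move=> /(_ _ mB); exact: FM.
Qed.

(** The overshoot of [maxsum] after its first passage above [a] is at most
    [maxsum r J e n], because [max(u, v)^r <= u^r + v^r]. *)
Lemma half_measure_escape (a b s : R) n B : 0 <= a -> 0 < b -> 0 < s ->
  2 * weak_const r * s `^ r <= b -> (n < N)%N -> F n B ->
  (forall x, B x -> Gam 0 n x <= a) ->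
  ((2^-1)%:E * P B <= P (B `\` ([set x | a + b < Gam 0 N x]%R `&` bounded_on D 0 N s)))%E.
Proof.
move=> a0 b0 s0 sb nN FB Ba; set E := _ `&` bounded_on _ _ _ _.
have mB := Fm FB.
have mE : measurable E.
  apply: measurableI; last exact: measurable_bounded_on.
  by apply: measurable_set_ltr; first exact: measurable_cst.
(* The vector bound starting at time [n] requires [D n <= s]. Restricting to [B2] loses nothing of
   [E], since [n < N] puts time [n] among those controlled by [bounded_on D 0 N s]. *)
pose B2 := B `&` [set x | (D n x <= s%:E)%E].
have FB2 : F n B2 by apply: (filtrationI FF) => //; exact: (filtration_cexp_le _ (gD n)).
have mB2 := Fm FB2.
pose k := (N - n)%N; have Nk : N = (n + k)%N by rewrite subnKC// ltnW.
pose W := B2 `&` bounded_on D n k s.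
have mW : measurable W by apply: measurableI => //; exact: measurable_bounded_on.
have BEW : B `&` E `<=` W `&` [set x | b < Gam n k x].
  move=> x [Bx [/= Gx bx]]; split.
    split; first split => //.
      by have := bx n nN; rewrite add0n.
    move=> i ik; have := bx (n + i)%N; rewrite add0n; apply.
    by rewrite Nk ltn_add2l.
  rewrite /= -(ltrD2l a); apply: (lt_le_trans Gx).
  rewrite {1}Nk; apply: (le_trans (maxsum_split r0 _ _ _ _ _)).
  by rewrite lerD2r; exact: Ba.
(* Chebyshev: on [B] and [E] the overshoot exceeds [b], while its integral over [W] is at most
   weak_const r s^r P(B2), that is at most b/2 P(B). *)
have PE : (b%:E * P (B `&` E) <= (b / 2)%:E * P B)%E.
  apply: (@le_trans _ _ (\int[P]_(x in W) (Gam n k x)%:E)%E).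
    apply: (@le_trans _ _ (\int[P]_(x in B `&` E) (Gam n k x)%:E)%E).
      rewrite -integral_cst; last exact: measurableI.
      apply: ge0_le_integral => //; first exact: measurableI.
      - by move=> x _; rewrite lee_fin ltW.
      - by apply: measurable_funTS; exact/measurable_EFinP.
      - by move=> x /BEW[_ /ltW]; rewrite lee_fin.
    apply: ge0_subset_integral => //; first exact: measurableI.
    - by apply: measurable_funTS; exact/measurable_EFinP.
    - by move=> x _; rewrite lee_fin maxsum_ge0.
    - by move=> x /BEW[].
  have := integral_sum_runmax_powR FF r1 mf f0 fe gD k s0 FB2 (fun x => @proj2 _ _).
  move=> /le_trans; apply.
  apply: (@le_trans _ _ ((b / 2)%:E * P B2)%E).
    by apply: lee_wpmul2r => //; rewrite lee_fin ler_pdivlMr// mulrC mulrA.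
  apply: lee_wpmul2l; first by rewrite lee_fin divr_ge0// ltW.
  by apply: le_measure; rewrite ?inE//; exact: subIsetl.
have PBE : (P B = P (B `\` E) + P (B `&` E))%E by exact: measureDI.
have mBD : measurable (B `\` E) by exact: measurableD.
have mBI : measurable (B `&` E) by exact: measurableI.
move: PE; rewrite PBE -(fineK (fin_num_measure P _ mBD)) -(fineK (fin_num_measure P _ mBI)).
rewrite -!EFinD -!EFinM !lee_fin; set y := fine (P (B `\` E)); set z := fine _ => PE.
have {}PE : z <= 2^-1 * (y + z) by rewrite -(ler_pM2l b0) mulrA.
by rewrite mulrDr -lerBrDr; move: PE; rewrite mulrDr; lra.
Qed.

(** On a first-hitting piece the indicator of the complement of [E] has conditional mean at least
    1/2; [muckenhoupt] with this indicator as [h] and [l = 1/2] leaves outside [E] a proportion 1 /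
    (2^q K) of the weight. *)
Lemma good_lambda (a b s : R) : 0 <= a -> 0 < b -> 0 < s ->
  2 * weak_const r * s `^ r <= b ->
  (\int[P]_(x in [set x | a + b < Gam 0 N x]%R) (w x)%:E <=
   (1 - (2 `^ q * K)^-1)%:E * \int[P]_(x in [set x | a < Gam 0 N x]%R) (w x)%:E +
   \int[P]_(x in ~` bounded_on D 0 N s) (w x)%:E)%E.
Proof.
move=> a0 b0 s0 sb.
set E1 := [set x | a + b < Gam 0 N x]; set U := [set x | a < Gam 0 N x].
set Bd := bounded_on D 0 N s; pose E := E1 `&` Bd.
have mE1 : measurable E1 by apply: measurable_set_ltr; first exact: measurable_cst.
have mU : measurable U by apply: measurable_set_ltr; first exact: measurable_cst.
have mBd : measurable Bd by exact: measurable_bounded_on.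
have mE : measurable E by exact: measurableI.
have K0 : 0 < K by exact: lt_le_trans K1.
pose c := (2 `^ q * K)^-1; have c0 : 0 < c by rewrite invr_gt0 mulr_gt0 ?powR_gt0.
pose Q n := [set x | a < Gam 0 n.+1 x].
have FQ n : F n (Q n) by exact: filtration_maxsum_gt.
have UE : \big[setU/set0]_(n < N) Q n = U.
  rewrite -bigcup_mkord; apply/seteqP; split=> [x [n nN Qx]|x Ux].
    exact: (lt_le_trans Qx (maxsum_mono r0 _ _ _ nN)).
  have [N0|N0] := posnP N; last by exists N.-1; rewrite /Q /= prednK.
  by move: Ux; rewrite /U N0 /= (maxsum0 r0) ltNge a0.
have w0' x : (0 <= (w x)%:E)%E by rewrite lee_fin ltW.
have hit : (\int[P]_(x in U) (c%:E * (w x)%:E) <=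
            \int[P]_(x in U) ((\1_(~` E) x)%:E * (w x)%:E))%E.
  have mindE : measurable_fun setT (fun x => (\1_(~` E) x : R)).
    by apply: measurable_indic; exact: measurableC.
  rewrite -UE; apply: le_integral_hitting.
  - by move=> n; exact: Fm (FQ n).
  - exact: measurable_funeM.
  - by apply: emeasurable_funM => //; exact/measurable_EFinP.
  - by move=> x; rewrite mule_ge0// lee_fin ltW.
  - by move=> x; rewrite mule_ge0// lee_fin.
  move=> n nN; set B := seqDU Q n.
  have FB : F n B by exact: (filtration_seqDU FF).
  (* Just before the hitting time the level has not been exceeded; at [n = 0] the window is empty
     and [maxsum] is 0, whence the condition [0 <= a]. *)
  have Ba x : B x -> Gam 0 n x <= a.
    case: n nN @B FB => [|n] nN B FB.
      by rewrite (maxsum0 r0).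
    move=> [_ nQ]; rewrite leNgt; apply/negP => aG; apply: nQ.
    by rewrite -bigcup_mkord; exists n => /=.
  have mB := Fm FB.
  have ind0 x : 0 <= (\1_(~` E) x : R) by [].
  have half0 : (0 : R) < 2^-1 by rewrite invr_gt0.
  have := wK FB mindE ind0 half0.
  have H B' : F n B' -> B' `<=` B ->
      ((2^-1)%:E * P B' <= \int[P]_(x in B') (\1_(~` E) x)%:E)%E.
    move=> FB' B'B; have mB' := Fm FB'.
    rewrite integral_indic//; last exact: measurableC.
    rewrite setIC -setDE; apply: (half_measure_escape a0 b0 s0 sb nN FB') => x /B'B.
    exact: Ba.
  move=> /(_ H); rewrite (_ : 2^-1 `^ q = (2 `^ q)^-1); last first.
    by rewrite -[in LHS]powR_inv1// -powRrM mulN1r powRN.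
  rewrite ge0_integralZl_EFin//; last 2 first.
  - exact: measurable_funTS.
  - exact: ltW.
  rewrite (eq_integral (fun x => (\1_(~` E) x `^ q * w x)%:E)
    (fun x => ((\1_(~` E) x)%:E * (w x)%:E)%E)); last first.
    move=> x _; rewrite EFinM indicE; case: (x \in _); first by rewrite powR1.
    by rewrite powR0// gt_eqF// (lt_le_trans ltr01).
  set Y := (\int[P]_(x in B) ((\1_(~` E) x)%:E * (w x)%:E))%E => wB.
  have := lee_wpmul2l (_ : (0 <= (K^-1)%:E)%E) wB.
  rewrite lee_fin invr_ge0 (ltW K0) => /(_ isT).
  rewrite !muleA -!EFinM mulVf ?gt_eqF// mul1e.
  by rewrite /c invfM mulrC.
(* Integrability of [w] makes all masses finite, so the mass outside [E] can be subtracted from that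
   of [U]. *)
pose wm A := (\int[P]_(x in A) (w x)%:E)%E.
have wfin A : measurable A -> wm A \is a fin_num.
  move=> mA; apply: integrable_fin_num => //.
  exact: (integrableS measurableT).
have mwA A : measurable_fun A (fun x => (w x)%:E) by exact: measurable_funTS.
have hitE : (\int[P]_(x in U) ((\1_(~` E) x)%:E * (w x)%:E) = wm (U `\` E))%E.
  rewrite /wm setDE integral_mkcondr; apply: eq_integral => x _.
  rewrite patchE indicE; case: (x \in _); first by rewrite mul1e.
  by rewrite mul0e.
have mUE : measurable (U `&` E) by exact: measurableI.
have mUD : measurable (U `\` E) by exact: measurableD.
have UDI : wm U = (wm (U `\` E) + wm (U `&` E))%E.
  rewrite -[in LHS](setUIDK U E) setUC /wm ge0_integral_setU//.
  by rewrite disj_set2E setIC; apply/eqP; rewrite -subset0 => x [[_ Ex] [_ nEx]].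
have E1sub : (wm E1 <= wm (U `&` E) + wm (~` Bd))%E.
  rewrite /wm -ge0_integral_setU//; last 2 first.
  - exact: measurableC.
  - by rewrite disj_set2E; apply/eqP; rewrite -subset0 => x [[_ [_ Bx]] nBx].
  apply: ge0_subset_integral => //.
    by apply: measurableU => //; exact: measurableC.
  move=> x E1x; have [Bx|nBx] := pselect (Bd x); last by right.
  by left; split => //; apply: le_lt_trans E1x; rewrite lerDl ltW.
apply: (le_trans E1sub); apply: leeD => //.
move: hit; rewrite hitE ge0_integralZl_EFin//; last exact: ltW.
rewrite -/(wm U) UDI.
rewrite -(fineK (wfin _ mUE)) -(fineK (wfin _ mUD)) -EFinD -!EFinM !lee_fin.
by rewrite -/c; lra.
Qed.

(** The step [b] and the bound [s] stay the same at each stage, so the factor becomes geometric in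
    [M] while the error grows only linearly. *)
Lemma good_lambda_iter (a b s : R) M : 0 <= a -> 0 < b -> 0 < s ->
  2 * weak_const r * s `^ r <= b ->
  (\int[P]_(x in [set x | a + M%:R * b < Gam 0 N x]%R) (w x)%:E <=
   ((1 - (2 `^ q * K)^-1) ^+ M)%:E * \int[P]_(x in [set x | a < Gam 0 N x]%R) (w x)%:E +
   M%:R%:E * \int[P]_(x in ~` bounded_on D 0 N s) (w x)%:E)%E.
Proof.
move=> a0 b0 s0 sb.
have I0 A : (0 <= \int[P]_(x in A) (w x)%:E)%E.
  by apply: integral_ge0 => x _; rewrite lee_fin ltW.
set k := 1 - _.
have c1 : (2 `^ q * K)^-1 <= 1.
  have K0 : 0 < K by exact: lt_le_trans K1.
  rewrite invf_le1 ?mulr_gt0 ?powR_gt0//.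
  have : 1 `^ q <= 2 `^ q.
    by apply: ge0_ler_powR; rewrite ?nnegrE// ?(le_trans ler01 q1)// ler1n.
  rewrite powR1 => h; apply: (le_trans K1); rewrite ler_peMl// ltW//.
have k0 : 0 <= k by rewrite subr_ge0.
have k1 : k <= 1.
  rewrite /k gerBl invr_ge0 mulr_ge0 ?powR_ge0//.
  exact: le_trans K1.
elim: M => [|M IH].
  by rewrite mul0r addr0 expr0 mul1e mul0e adde0.
rewrite (_ : a + _ = a + M%:R * b + b); last by rewrite -natr1; ring.
have aM : 0 <= a + M%:R * b by rewrite addr_ge0// mulr_ge0// ltW.
apply: (le_trans (good_lambda aM b0 s0 sb)).
apply: (@le_trans _ _ (k%:E * ((k ^+ M)%:E * \int[P]_(x in [set x | a < Gam 0 N x]%R) (w x)%:E +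
   M%:R%:E * \int[P]_(x in ~` bounded_on D 0 N s) (w x)%:E) +
   \int[P]_(x in ~` bounded_on D 0 N s) (w x)%:E))%E.
  by apply: leeD => //; apply: lee_wpmul2l.
rewrite ge0_muleDr ?mule_ge0// ?lee_fin ?exprn_ge0//.
rewrite muleA -EFinM -exprS -addeA; apply: leeD => //.
rewrite muleA -EFinM -natr1 EFinD ge0_muleDl ?lee_fin// mul1e; apply: leeD => //.
by apply: lee_wpmul2r => //; rewrite lee_fin ler_piMl.
Qed.

End GoodLambda.

(** * Weighted weak type inequality for the scalar maximal function *)

Section ScalarWeak.
Context d (T : measurableType d) (R : realType) (P : probability T R).
Variables (F : nat -> set (set T)) (FF : filtration F).
Variables (g : T -> R) (D : nat -> T -> \bar R).
Hypotheses (mg : measurable_fun setT g) (g0 : forall x, 0 <= g x)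
  (gD : forall n, cexp_nonneg P (F n) (EFin \o g) (D n)).
Variables (w : T -> R) (q K : R).
Hypotheses (w0 : forall x, 0 < w x) (mw : measurable_fun setT w)
  (K0 : 0 < K) (wK : muckenhoupt P F w q K).

Let Fm n A : F n A -> measurable A.
Proof. exact: filtration_sub. Qed.

(** Where [D n] first exceeds [s], the part of [g] above [s / 2] keeps conditional mean at least
    [s / 2], and [muckenhoupt] applies to that part. The truncation is what makes the later sum over
    dyadic [s] converge. *)
Lemma weak_maximal (s : R) N : 0 < s ->
  (((s / 2) `^ q)%:E * \int[P]_(x in ~` bounded_on D 0 N s) (w x)%:E <=
   K%:E * \int[P]_x ((g x * \1_[set x | s / 2 < g x] x) `^ q * w x)%:E)%E.
Proof.
move=> s0; have s20 : 0 < s / 2 by exact: divr_gt0.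
pose S := [set x | s / 2 < g x].
have mS : measurable S by apply: measurable_set_ltr => //; exact: measurable_cst.
pose h x := g x * \1_S x.
have mh : measurable_fun setT h.
  by apply: measurable_funM => //; exact: measurable_indic.
have h0 x : 0 <= h x by rewrite mulr_ge0.
have mEh : measurable_fun setT (EFin \o h) by exact/measurable_EFinP.
have mEw : measurable_fun setT (EFin \o w) by exact/measurable_EFinP.
pose Q n := [set x | (s%:E < D n x)%E].
have FQ n : F n (Q n) by exact: (filtration_cexp_gt FF _ (gD n)).
have mQ n := Fm (FQ n).
have QE : \big[setU/set0]_(n < N) Q n = ~` bounded_on D 0 N s.
  rewrite -bigcup_mkord; apply/seteqP; split=> x.
    by move=> [n /= nN]; rewrite /Q /= ltNge => /negP nD /(_ n nN).
  move=> nb; apply: contrapT => nQ; apply: nb => i iN.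
  rewrite leNgt; apply/negP => Di; apply: nQ; exists i => //.
have mhw : measurable_fun setT (fun x => (h x `^ q * w x)%:E).
  apply/measurable_EFinP; apply: measurable_funM => //.
  exact: (measurableT_comp (measurable_powR q)).
have hw0 x : (0 <= (h x `^ q * w x)%:E)%E.
  by rewrite lee_fin mulr_ge0 ?powR_ge0// ltW.
have mU : measurable (\big[setU/set0]_(n < N) Q n) by exact: bigsetU_measurable.
have main : (\int[P]_(x in \big[setU/set0]_(n < N) Q n) (((s / 2) `^ q)%:E * (w x)%:E) <=
   \int[P]_(x in \big[setU/set0]_(n < N) Q n) (K%:E * (h x `^ q * w x)%:E))%E.
  apply: le_integral_hitting => //.
  - exact: measurable_funeM.
  - exact: measurable_funeM.
  - by move=> x; apply: mule_ge0; rewrite lee_fin ?powR_ge0// ltW.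
  - by move=> x; apply: mule_ge0; rewrite // lee_fin ltW.
  move=> n _; set B := seqDU Q n.
  have FB : F n B by exact: (filtration_seqDU FF).
  have mB := Fm FB.
  have BQ : B `<=` Q n by exact: subset_seqDU.
  have KB : (\int[P]_(x in B) (K%:E * (h x `^ q * w x)%:E) =
      K%:E * \int[P]_(x in B) (h x `^ q * w x)%:E)%E.
    by rewrite ge0_integralZl_EFin//; [exact: measurable_funTS|exact: ltW].
  have sB : (\int[P]_(x in B) (((s / 2) `^ q)%:E * (w x)%:E) =
      ((s / 2) `^ q)%:E * \int[P]_(x in B) (w x)%:E)%E.
    rewrite ge0_integralZl_EFin ?powR_ge0//; last exact: measurable_funTS.
    by move=> x _; rewrite lee_fin ltW.
  rewrite KB sB; apply: (wK FB mh h0 s20) => B' FB' B'B.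
  have mB' := Fm FB'.
  have gs : (s%:E * P B' <= \int[P]_(x in B') (g x)%:E)%E.
    have [_ [_ /(_ _ FB') <-]] := gD n.
    rewrite -integral_cst//; apply: ge0_le_integral => //.
    - by move=> x _; rewrite lee_fin ltW.
    - exact: measurable_funTS (cexp_measurable FF (gD n)).
    - by move=> x /B'B /BQ; rewrite /Q /= => /ltW.
  have gh : (\int[P]_(x in B') (g x)%:E <= \int[P]_(x in B') (h x)%:E + (s / 2)%:E * P B')%E.
    rewrite -integral_cst// -ge0_integralD//; last 3 first.
    - by move=> x _; rewrite lee_fin.
    - exact: measurable_funTS.
    - by move=> x _; rewrite lee_fin ltW.
    apply: ge0_le_integral => //.
    - by move=> x _; rewrite lee_fin.
    - by apply: measurable_funTS; exact/measurable_EFinP.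
    - by apply: emeasurable_funD => //; exact: measurable_funTS.
    move=> x _; rewrite -EFinD lee_fin /h indicE.
    have [_|] := boolP (x \in _); first by rewrite mulr1 lerDl ltW.
    by rewrite notin_setE /S /= mulr0 add0r => /negP; rewrite -leNgt.
  have PBE : P B' = (fine (P B'))%:E by rewrite fineK// fin_num_measure.
  have : (0 <= \int[P]_(x in B') (h x)%:E)%E by apply: integral_ge0 => x _; rewrite lee_fin.
  move: (le_trans gs gh); rewrite PBE; case: (integral _ _ _) => [X| |//].
    rewrite -!EFinM -EFinD !lee_fin => H _; move: H.
    by rewrite {1}(splitr s) mulrDl lerD2r.
  by move=> _ _; rewrite leey.
apply: le_trans (le_trans _ main) _.
  rewrite QE ge0_integralZl_EFin ?powR_ge0//; last exact: measurable_funTS.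
    by rewrite -QE.
  by move=> x _; rewrite lee_fin ltW.
rewrite -ge0_integralZl_EFin//; [|by move=> x _; exact: hw0|exact: ltW].
apply: ge0_subset_integral => //.
  exact: measurable_funeM.
by move=> x _; apply: mule_ge0; rewrite // lee_fin ltW.
Qed.

End ScalarWeak.

(** * Summation over dyadic levels *)

Lemma expr_small (R : realType) (k e : R) : 0 <= k < 1 -> 0 < e ->
  exists2 M, (0 < M)%N & k ^+ M <= e.
Proof.
move=> /andP[k0 k1] e0.
have : (fun n => k ^+ n) @ \oo --> (0 : R) by apply: cvg_expr; rewrite ger0_norm.
move=> /cvgrPdist_le/(_ e e0)[N _ H]; exists N.+1 => //.
by have := H N.+1 (leqnSn N); rewrite /= sub0r normrN ger0_norm ?exprn_ge0.
Qed.

(** The sum is extended to an index [n] with [a n <= 1]; shifting it by one index costs at most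
    [a n], and half of the finite sum is absorbed. *)
Lemma halving_sum_bound (R : realFieldType) (a b : nat -> R) (C B : R) I :
  (forall i, 0 <= a i) -> (forall i, a i <= 2^-1 * a i.+1 + C * b i.+1) ->
  0 <= C -> (forall n, \sum_(i < n) b i.+1 <= B) ->
  (forall e, 0 < e -> exists2 n, (I <= n)%N & a n <= e) ->
  \sum_(i < I) a i <= 1 + 2 * (C * B).
Proof.
move=> a0 ab C0 bB asmall; have [n In an] := asmall 1 ltr01.
apply: (@le_trans _ _ (\sum_(i < n) a i)).
  rewrite -!(big_mkord xpredT a) (@big_cat_nat _ _ _ I 0 n)//= lerDl.
  exact: sumr_ge0.
have : \sum_(i < n) a i <= 2^-1 * \sum_(i < n) a i.+1 + C * \sum_(i < n) b i.+1.
  by rewrite !mulr_sumr -big_split/=; apply: ler_sum => i _; exact: ab.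
have E : \sum_(i < n) a i + a n = a 0%N + \sum_(i < n) a i.+1.
  transitivity (\sum_(i < n.+1) a i); first by rewrite big_ord_recr.
  by rewrite big_ord_recl.
have := ler_wpM2l C0 (bB n); have := a0 0%N; lra.
Qed.

Section MusielakOrlicz.
Context d (T : measurableType d) (R : realType) (P : probability T R).
Variables (F : nat -> set (set T)) (FF : filtration F) (phi : T -> R -> R).
Variables (pm pp q K Cl Cu r : R).
Hypotheses (phi_ge0 : forall x t, 0 <= t -> 0 <= phi x t)
  (mphi : forall t, 0 <= t -> measurable_fun setT (phi ^~ t))
  (phi_gt0 : forall t, 0 < t -> forall x, 0 < phi x t)
  (iphi : forall t, 0 <= t -> P.-integrable setT (EFin \o phi ^~ t)).
Hypotheses (Cl0 : 0 < Cl) (Cu0 : 0 < Cu)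
  (phi_lower : forall x t s, 0 <= t -> 0 < s < 1 ->
    phi x (s * t) <= Cl * s `^ pm * phi x t)
  (phi_upper : forall x t s, 0 <= t -> 1 <= s ->
    phi x (s * t) <= Cu * s `^ pp * phi x t).
Hypotheses (q1 : 1 <= q) (qpm : q < pm) (K1 : 1 <= K) (r1 : 1 < r)
  (phiK : forall t, 0 < t -> muckenhoupt P F (phi ^~ t) q K).

Let r0 : 0 < r. Proof. exact: lt_trans ltr01 r1. Qed.
Let q0 : 0 < q. Proof. exact: lt_le_trans ltr01 q1. Qed.

Let kappa := 1 - (2 `^ q * K)^-1.

Let kappa01 : 0 <= kappa < 1.
Proof.
have K0 : 0 < K by exact: lt_le_trans K1.
rewrite subr_ge0 ltrBlDr ltrDl invr_gt0 mulr_gt0 ?powR_gt0// andbT.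
rewrite invf_le1 ?mulr_gt0 ?powR_gt0//.
have : 1 `^ q <= 2 `^ q.
  by apply: ge0_ler_powR; rewrite ?nnegrE// ?(ltW q0)// ler1n.
by rewrite powR1 => h; rewrite (le_trans K1)// ler_peMl// ltW.
Qed.

(** The weight is frozen at [phi ^~ (2 * t)] while the level runs through [M]
    equal steps from [t^r] to [(2t)^r]; this makes the good-lambda factor beat the
    doubling constant of [phi]. *)
Lemma level_decay : exists C gam : R, [/\ 0 < C, 0 < gam & gam <= 1 /\
  forall (J N : nat) (f : nat -> T -> R) (e : nat -> nat -> T -> R)
    (D : nat -> T -> \bar R) (t : R),
  (forall j, measurable_fun setT (f j)) -> (forall j x, 0 <= f j x) ->
  (forall j n, cexp_nonneg P (F n) (EFin \o f j) (EFin \o e j n)) ->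
  (forall n, cexp_nonneg P (F n) (EFin \o lnorm r J f) (D n)) -> 0 < t ->
  (\int[P]_(x in [set x | ((2 * t) `^ r < maxsum r J e 0 N x)%R]) (phi x (2 * t))%:E <=
   (2^-1)%:E * \int[P]_(x in [set x | (t `^ r < maxsum r J e 0 N x)%R]) (phi x t)%:E +
   C%:E * \int[P]_(x in ~` bounded_on D 0 N (gam * t)) (phi x t)%:E)%E].
Proof.
pose L := Cu * 2 `^ pp; have L0 : 0 < L by rewrite mulr_gt0 ?powR_gt0.
(* [L] is the doubling constant of [phi]; the number of steps [M] must give kappa^M L <= 1/2 once
   the weight at [2 * t] is compared with that at [t]. *)
have e0 : 0 < 2^-1 / L by rewrite divr_gt0 ?invr_gt0.
have [M M0 kM] := expr_small kappa01 e0.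
have M0' : 0 < M%:R :> R by rewrite ltr0n.
have wc0 := weak_const_gt0 r1.
have r21 : 0 < 2 `^ r - 1.
  rewrite subr_gt0; have : 1 `^ r < 2 `^ r by apply: gt0_ltr_powR; rewrite ?nnegrE// ltr1n.
  by rewrite powR1.
pose Z := (2 `^ r - 1) / (2 * weak_const r * M%:R).
have Z0 : 0 < Z by rewrite divr_gt0 ?mulr_gt0.
pose gam := Num.min 1 (Z `^ r^-1).
have gam0 : 0 < gam by rewrite lt_min ltr01 powR_gt0.
exists (L * M%:R), gam; split=> //; first by rewrite mulr_gt0.
split; first by rewrite ge_min lexx.
move=> J N f e D t mf f0 fe gD t0.
have t20 : 0 < 2 * t by rewrite mulr_gt0.
have tr0 : 0 < t `^ r by exact: powR_gt0.
pose b := t `^ r * (2 `^ r - 1) / M%:R.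
have b0 : 0 < b by rewrite divr_gt0 ?mulr_gt0.
have s0 : 0 < gam * t by rewrite mulr_gt0.
have gamZ : gam `^ r <= Z.
  have ZE : (Z `^ r^-1) `^ r = Z.
    by rewrite -powRrM mulVf ?gt_eqF// powRr1// ltW.
  rewrite -[leRHS]ZE; apply: ge0_ler_powR; rewrite ?nnegrE ?powR_ge0 ?(ltW r0) ?(ltW gam0)//.
  by rewrite ge_min lexx orbT.
have sb : 2 * weak_const r * (gam * t) `^ r <= b.
  rewrite powRM ?(ltW gam0) ?(ltW t0)//.
  apply: (@le_trans _ _ (2 * weak_const r * (Z * t `^ r))).
    by rewrite ler_wpM2l ?mulr_ge0 ?(ltW wc0)// ler_wpM2r ?(ltW tr0).
  rewrite le_eqVlt; apply/orP; left; apply/eqP; rewrite /Z /b; field.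
  by rewrite !gt_eqF.
have := good_lambda_iter FF r1 N mf f0 fe gD (phi_gt0 t20) (iphi (ltW t20)) q1 K1 (phiK t20)
  M (ltW tr0) b0 s0 sb.
have -> : t `^ r + M%:R * b = (2 * t) `^ r.
  by rewrite powRM ?(ltW t0)// /b; field; rewrite gt_eqF.
move=> /le_trans; apply.
have cmp A : measurable A -> (\int[P]_(x in A) (phi x (2 * t))%:E <=
    L%:E * \int[P]_(x in A) (phi x t)%:E)%E.
  move=> mA; have mt : measurable_fun A (fun x => (phi x t)%:E).
    by apply: measurable_funTS; apply/measurable_EFinP; exact: mphi (ltW t0).
  rewrite -ge0_integralZl_EFin//; last 2 first.
  - by move=> x _; rewrite lee_fin phi_ge0// ltW.
  - exact: ltW.
  apply: ge0_le_integral => //.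
  - by move=> x _; rewrite lee_fin phi_ge0// ltW.
  - by apply: measurable_funTS; apply/measurable_EFinP; exact: mphi (ltW t20).
  - exact: measurable_funeM.
  by move=> x _; rewrite -EFinM lee_fin; apply: phi_upper; rewrite ?ler1n// ltW.
have mG : measurable_fun setT (maxsum r J e 0 N).
  apply: measurable_maxsum => j i _; apply/measurable_EFinP.
  exact: (cexp_measurable FF (fe j (0 + i)%N)).
have mBd : measurable (bounded_on D 0 N (gam * t)).
  by apply: measurable_bounded_on => n; exact: (cexp_measurable FF (gD n)).
have I0 A : (0 <= \int[P]_(x in A) (phi x t)%:E)%E.
  by apply: integral_ge0 => x _; rewrite lee_fin phi_ge0// ltW.
have /andP[k0 _] := kappa01.
apply: leeD.
  have mU : measurable [set x | t `^ r < maxsum r J e 0 N x].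
    by apply: measurable_set_ltr => //; exact: measurable_cst.
  apply: le_trans (lee_wpmul2l _ (cmp _ mU)) _; first by rewrite lee_fin exprn_ge0.
  rewrite muleA -EFinM; apply: lee_wpmul2r => //.
  by rewrite lee_fin -ler_pdivlMr.
rewrite (mulrC L) EFinM -muleA; apply: lee_wpmul2l; first by rewrite lee_fin.
exact/cmp/measurableC.
Qed.

(** Put s = 2 g / gam: only levels t < s count, and the lower type bounds their terms by (s/t)^q
    (t/s)^pm phi(x, s) up to [Cl]. The exponent pm - q > 0 makes the sum geometric, and the upper
    type brings phi(x, s) back to phi(x, g). *)
Lemma scalar_level_sum (gam : R) : 0 < gam <= 1 -> exists2 C : R, 0 < C &
  forall (T0 g : R) x I, 0 < T0 -> 0 <= g ->
  \sum_(i < I) (if gam * (T0 / 2 ^+ i) / 2 < g then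
     ((gam * (T0 / 2 ^+ i) / 2) `^ q)^-1 * (g `^ q * phi x (T0 / 2 ^+ i)) else 0)
  <= C * phi x g.
Proof.
move=> /andP[gam0 gam1].
pose c := 1 - (2 `^ (pm - q))^-1.
have pq0 : 0 < pm - q by rewrite subr_gt0.
have c0 : 0 < c.
  rewrite subr_gt0 invf_lt1 ?powR_gt0//.
  have : 1 `^ (pm - q) < 2 `^ (pm - q) by apply: gt0_ltr_powR; rewrite ?nnegrE// ltr1n.
  by rewrite powR1.
have g21 : 1 <= 2 / gam by rewrite ler_pdivlMr// mul1r (le_trans gam1)// ler1n.
exists (Cl / c * (Cu * (2 / gam) `^ pp)).
  by rewrite !mulr_gt0 ?invr_gt0 ?powR_gt0// (lt_le_trans ltr01 g21).
move=> T0 g x I T00 g0.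
have [->|gn0] := eqVneq g 0.
  rewrite big1 ?mulr_ge0 ?phi_ge0 ?powR_ge0 ?invr_ge0 ?(ltW c0) ?(ltW Cl0) ?(ltW Cu0)//.
  move=> i _; rewrite ifF//; apply/negbTE; rewrite -leNgt.
  by rewrite !mulr_ge0 ?invr_ge0 ?exprn_ge0 ?(ltW gam0) ?(ltW T00).
have {gn0}g0' : 0 < g by rewrite lt_neqAle eq_sym gn0 g0.
pose s := 2 / gam * g; have s0 : 0 < s by rewrite mulr_gt0// (lt_le_trans ltr01 g21).
have ts t : (gam * t / 2 < g) = (t < s).
  by rewrite ltr_pdivrMr// mulrC -ltr_pdivlMr// /s; congr (_ < _); ring.
have phis : phi x s <= Cu * (2 / gam) `^ pp * phi x g by exact: phi_upper.
apply: (@le_trans _ _ (Cl / c * phi x s)); last first.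
  by rewrite -[leRHS]mulrA ler_wpM2l// divr_ge0// ltW.
apply: (@le_trans _ _ (Cl * (s `^ (pm - q))^-1 * phi x s *
   \sum_(i < I) (if T0 / 2 ^+ i <= s then (T0 / 2 ^+ i) `^ (pm - q) else 0))); last first.
  apply: le_trans (ler_wpM2l _ (geometric_dyadic_sum I pq0 (ltW s0) T00)) _.
    by rewrite !mulr_ge0 ?invr_ge0 ?powR_ge0 ?phi_ge0 ?(ltW Cl0) ?(ltW s0).
  rewrite le_eqVlt; apply/orP; left; apply/eqP; rewrite -/c; field.
  by rewrite !gt_eqF ?powR_gt0.
rewrite mulr_sumr; apply: ler_sum => i _; set t := T0 / 2 ^+ i.
have t0 : 0 < t by rewrite divr_gt0 ?exprn_gt0.
rewrite ts; case: ifPn => [tls|_]; last first.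
  case: ifP => _; rewrite ?mulr0// !mulr_ge0 ?invr_ge0 ?powR_ge0 ?phi_ge0 ?(ltW Cl0) ?(ltW s0)//.
rewrite (ltW tls).
have tq : ((gam * t / 2) `^ q)^-1 * g `^ q = s `^ q / t `^ q.
  rewrite (_ : gam * t / 2 = g * (t / s)); last first.
    by rewrite /s; field; rewrite !gt_eqF.
  rewrite powRM ?(ltW g0') ?divr_ge0 ?exprn_ge0 ?(ltW T00) ?(ltW s0)//.
  rewrite powRM ?invr_ge0 ?(ltW t0) ?(ltW s0)//.
  rewrite -[s^-1]powR_inv1 ?(ltW s0)// -powRrM mulN1r powRN; field.
  by rewrite !gt_eqF ?powR_gt0.
rewrite mulrA tq.
have pt : phi x t <= Cl * (t / s) `^ pm * phi x s.
  have := phi_lower x (ltW s0) (_ : 0 < t / s < 1); rewrite divfK ?gt_eqF//; apply.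
  by rewrite divr_gt0//= ltr_pdivrMr// mul1r.
apply: le_trans (ler_wpM2l _ pt) _; first by rewrite divr_ge0 ?powR_ge0.
rewrite le_eqVlt; apply/orP; left; apply/eqP.
rewrite powRM ?invr_ge0 ?(ltW t0) ?(ltW s0)//.
rewrite -[s^-1]powR_inv1 ?(ltW s0)// -powRrM mulN1r powRN.
rewrite !powRB ?(gt_eqF t0) ?(gt_eqF s0) ?implybT//.
by field; rewrite !gt_eqF ?powR_gt0.
Qed.

(** [halving_sum_bound] is applied to the masses [a i] of the level sets of [maxsum] and [b i] of
    those of the scalar maximal function. [C] is chosen before [J], [N], [T0] and [I], which permits
    the later limits. *)
Lemma finite_horizon_bound : exists2 C : R, 0 < C &
  forall (J N : nat) (f : nat -> T -> R) (e : nat -> nat -> T -> R) (D : nat -> T -> \bar R),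
  (forall j, measurable_fun setT (f j)) -> (forall j x, 0 <= f j x) ->
  (forall j n, cexp_nonneg P (F n) (EFin \o f j) (EFin \o e j n)) ->
  (forall n, cexp_nonneg P (F n) (EFin \o lnorm r J f) (D n)) ->
  (\int[P]_x (phi x (lnorm r J f x))%:E <= 1)%E ->
  forall (T0 : R) I, 0 < T0 ->
  (\sum_(i < I) \int[P]_(x in [set x | ((T0 / 2 ^+ i) `^ r < maxsum r J e 0 N x)%R])
     (phi x (T0 / 2 ^+ i))%:E <= C%:E)%E.
Proof.
have [C1 [gam [C10 gam0 [gam1 decay]]]] := level_decay.
have [|C2 C20 scal] := @scalar_level_sum gam; first by rewrite gam0.
have K0 : 0 < K by exact: lt_le_trans K1.
exists (1 + 2 * (C1 * (K * C2))).
  by rewrite addr_gt0// !mulr_gt0.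
move=> J N f e D mf f0 fe gD fphi T0 I T00.
set g := lnorm r J f; have mg : measurable_fun setT g by exact: measurable_lnorm.
have g0 x : 0 <= g x by exact: lnorm_ge0.
pose t i := T0 / 2 ^+ i; have t0 i : 0 < t i by rewrite divr_gt0 ?exprn_gt0.
have mphit i A : measurable_fun A (fun x => (phi x (t i))%:E).
  by apply: measurable_funTS; apply/measurable_EFinP; exact: mphi (ltW (t0 i)).
have phi0 i x : (0 <= (phi x (t i))%:E)%E by rewrite lee_fin phi_ge0// ltW.
pose A i := [set x | t i `^ r < maxsum r J e 0 N x].
pose Bd i := ~` bounded_on D 0 N (gam * t i).
have mG : measurable_fun setT (maxsum r J e 0 N).
  apply: measurable_maxsum => j i _; apply/measurable_EFinP.
  exact: (cexp_measurable FF (fe j (0 + i)%N)).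
have mA i : measurable (A i) by apply: measurable_set_ltr => //; exact: measurable_cst.
have mBd i : measurable (Bd i).
  by apply: measurableC; apply: measurable_bounded_on => n; exact: (cexp_measurable FF (gD n)).
pose wint i S := (\int[P]_(x in S) (phi x (t i))%:E)%E.
have wfin i S : measurable S -> wint i S \is a fin_num.
  move=> mS; apply: integrable_fin_num => //.
  apply: (integrableS measurableT) => //; exact: iphi (ltW (t0 i)).
have wge0 i S : (0 <= wint i S)%E by apply: integral_ge0.
pose a i := fine (wint i (A i)); pose b i := fine (wint i (Bd i)).
have aE i : wint i (A i) = (a i)%:E by rewrite fineK// wfin.
have bE i : wint i (Bd i) = (b i)%:E by rewrite fineK// wfin.
under eq_bigr => i _ do rewrite -/(t i) -/(A i) -/(wint i (A i)) aE.
rewrite sumEFin lee_fin; apply: (@halving_sum_bound _ a b).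
- by move=> i; exact: fine_ge0.
- move=> i; have := decay J N f e D (t i.+1) mf f0 fe gD (t0 i.+1).
  rewrite (_ : 2 * t i.+1 = t i); last by rewrite /t exprS; field; rewrite gt_eqF// exprn_gt0.
  rewrite -/(A i) -/(A i.+1) -/(Bd i.+1) -/(wint i (A i)) -/(wint i.+1 (A i.+1)).
  by rewrite -/(wint i.+1 (Bd i.+1)) !aE bE -!EFinM -EFinD lee_fin.
- exact: ltW.
- move=> n; apply: (@le_trans _ _ (\sum_(i < n.+1) b i)).
    by rewrite big_ord_recl/= lerDr fine_ge0.
  pose be i x : \bar R := (if gam * t i / 2 < g x then
     ((gam * t i / 2) `^ q)^-1 * (g x `^ q * phi x (t i)) else 0)%:E.
  have be0 i x : (0 <= be i x)%E.
    rewrite /be lee_fin; case: ifP => // _.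
    by rewrite mulr_ge0 ?invr_ge0 ?powR_ge0// mulr_ge0 ?powR_ge0// phi_ge0// ltW.
  have gt2 i : 0 < gam * t i / 2 by rewrite !mulr_gt0.
  have beE i : be i = (fun x => (((gam * t i / 2) `^ q)^-1)%:E *
     ((g x * \1_[set x | gam * t i / 2 < g x] x) `^ q * phi x (t i))%:E)%E.
    apply/funext => x; rewrite /be indicE -EFinM.
    have [|] := boolP (x \in _); first by rewrite inE /= => ->; rewrite mulr1.
    by rewrite notin_setE /= => /negP/negbTE ->; rewrite mulr0 powR0 ?gt_eqF// mul0r mulr0.
  have mh i : measurable_fun setT (fun x =>
     ((g x * \1_[set x | gam * t i / 2 < g x] x) `^ q * phi x (t i))%:E).
    apply/measurable_EFinP; apply: measurable_funM; last exact: mphi (ltW (t0 i)).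
    apply: (measurableT_comp (measurable_powR q)); apply: measurable_funM => //.
    by apply: measurable_indic; apply: measurable_set_ltr => //; exact: measurable_cst.
  have mbe i : measurable_fun setT (be i).
    by rewrite beE; exact: measurable_funeM.
  have bbe i : ((b i)%:E <= K%:E * \int[P]_x be i x)%E.
    have := weak_maximal FF mg g0 gD (phi_gt0 (t0 i)) (mphi (ltW (t0 i))) K0 (phiK (t0 i)) N
      (mulr_gt0 gam0 (t0 i)).
    have u0 : 0 < ((gam * t i / 2) `^ q)^-1 by rewrite invr_gt0 powR_gt0.
    move=> H; have := lee_wpmul2l (_ : (0 <= (((gam * t i / 2) `^ q)^-1)%:E)%E) H.
    rewrite lee_fin => /(_ (ltW u0)).
    rewrite muleA -EFinM mulVf ?gt_eqF ?powR_gt0// mul1e -/(Bd i) -/(wint i (Bd i)) bE.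
    move=> /le_trans; apply; rewrite muleCA beE ge0_integralZl_EFin//; last exact: ltW.
    by move=> x _; rewrite lee_fin mulr_ge0 ?powR_ge0// phi_ge0// ltW.
  rewrite -lee_fin -sumEFin.
  apply: (@le_trans _ _ (\sum_(i < n.+1) (K%:E * \int[P]_x be i x))%E).
    by apply: lee_sum => i _.
  rewrite -ge0_sume_distrr; last by move=> i _; exact: integral_ge0.
  rewrite EFinM; apply: lee_wpmul2l; first by rewrite lee_fin ltW.
  rewrite -ge0_integral_sum//.
  have msum : measurable_fun setT (fun x => \sum_(i < n.+1) be i x)%E by exact: emeasurable_sum.
  rewrite -[leRHS]mule1.
  (* The constant is moved onto the measurable sum: the integral of [phi x (g x)] may be only a
     lower integral and is used by pointwise comparison alone. *)
  apply: (@le_trans _ _ (C2%:E * \int[P]_x ((C2^-1)%:E * \sum_(i < n.+1) be i x))%E).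
    rewrite ge0_integralZl_EFin//; last 2 first.
    - by move=> x _; exact: sume_ge0.
    - by rewrite invr_ge0 ltW.
    by rewrite muleA -EFinM mulfV ?gt_eqF// mul1e.
  apply: lee_wpmul2l; first by rewrite lee_fin ltW.
  apply: le_trans fphi; apply: le_lower_integral => x.
    by apply: mule_ge0; [rewrite lee_fin invr_ge0 ltW|exact: sume_ge0].
  rewrite sumEFin -EFinM lee_fin ler_pdivrMl//.
  exact: scal.
(* The lower type with [pm >= 1] gives phi(x, T0 / 2^n) <= Cl 2^(-n) phi(x, T0), and the last
   function is integrable. A positive [n] is required because the scaling factor must be below 1. *)
- move=> ep ep0.
  pose fb := fine (\int[P]_x (phi x T0)%:E)%E.
  have fb0 : 0 <= fb.
    by apply: fine_ge0; apply: integral_ge0 => x _; rewrite lee_fin phi_ge0// ltW.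
  have fbE : (\int[P]_x (phi x T0)%:E = fb%:E)%E.
    by rewrite fineK//; apply: integrable_fin_num => //; exact: iphi (ltW T00).
  have h1 : 0 <= (2^-1 : R) < 1 by rewrite invr_ge0 ler0n invf_lt1// ltr1n.
  have h2 : 0 < ep / (Cl * fb + 1).
    by rewrite divr_gt0// ltr_wpDl// mulr_ge0// ltW.
  have [M M0 HM] := expr_small h1 h2.
  exists (I + M)%N; first by rewrite leq_addr.
  set n := (I + M)%N; have n0 : (0 < n)%N by rewrite addn_gt0 M0 orbT.
  have twon : 0 < ((2 : R) ^+ n)^-1 < 1.
    by rewrite invr_gt0 exprn_gt0//= invf_lt1 ?exprn_gt0// exprn_egt1 ?ltr1n// -lt0n.
  have /andP[twon0 twon1] := twon.
  have pm1 : 1 <= pm by rewrite (le_trans q1)// ltW.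
  have : (wint n (A n) <= (Cl * (2 ^+ n)^-1)%:E * fb%:E)%E.
    rewrite -fbE -ge0_integralZl_EFin//; last 3 first.
    - by move=> x _; rewrite lee_fin phi_ge0// ltW.
    - by apply/measurable_EFinP; exact: mphi (ltW T00).
    - by rewrite mulr_ge0// ltW.
    apply: (@le_trans _ _ (wint n setT)); first exact: ge0_subset_integral.
    apply: ge0_le_integral => //.
    - by apply: measurable_funeM; apply/measurable_EFinP; exact: mphi (ltW T00).
    move=> x _; rewrite -EFinM lee_fin /t mulrC.
    apply: le_trans (phi_lower x (ltW T00) twon) _.
    rewrite ler_wpM2r ?phi_ge0 ?(ltW T00)// ler_wpM2l ?(ltW Cl0)//.
    by apply: ge1r_powR => //; rewrite twon0 ltW.
  rewrite aE -EFinM lee_fin => /le_trans; apply.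
  rewrite mulrAC; apply: (@le_trans _ _ ((Cl * fb + 1) * 2^-1 ^+ M)).
    apply: ler_pM; rewrite ?mulr_ge0 ?invr_ge0 ?exprn_ge0 ?(ltW Cl0)//.
      by rewrite lerDl.
    rewrite -exprVn ler_wiXn2l ?leq_addl//; by case/andP: h1 => _ /ltW.
  by rewrite mulrC -ler_pdivlMr// ltr_wpDl// mulr_ge0// ltW.
Qed.

End MusielakOrlicz.

(** * Passage to infinitely many functions and times *)

Lemma sum_sup_le (R : realType) (u : nat -> nat -> R) J B :
  (forall j n m, (n <= m)%N -> u j n <= u j m) ->
  (forall N, \sum_(j < J) u j N <= B) ->
  \sum_(j < J) sup (range (u j)) <= B.
Proof.
move=> um; elim: J B => [|J IH] B uB.
  by rewrite big_ord0; have := uB 0%N; rewrite big_ord0.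
(* The last supremum is bounded value by value; monotonicity lets the value at [n] and the other
   summands at [N] share the time [maxn N n]. *)
rewrite big_ord_recr/= -lerBrDl; apply: ge_sup; first by exists (u J 0%N), 0%N.
move=> _ [n _ <-]; rewrite lerBrDl -lerBrDr; apply: IH => N.
rewrite lerBrDr; apply: le_trans (uB (maxn N n)); rewrite big_ord_recr/=.
apply: lerD; last exact/um/leq_maxr.
by apply: ler_sum => j _; exact/um/leq_maxl.
Qed.

Section VectorMaxfun.
Context d (T : measurableType d) (R : realType) (r : R) (r1 : 1 < r)
  (e E : nat -> nat -> T -> R) (l : R) (x : T).
Hypotheses (l0 : 0 < l)
  (eE : forall j n, `|E j n x| <= l * e j n x).

Let r0 : 0 < r. Proof. exact: lt_trans ltr01 r1. Qed.

Lemma maxsum_mono_dim J J' N N' : (J <= J')%N -> (N <= N')%N ->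
  maxsum r J e 0 N x <= maxsum r J' e 0 N' x.
Proof.
move=> JJ NN; apply: le_trans (maxsum_mono r0 _ _ _ NN) _.
rewrite /maxsum -!(big_mkord xpredT (fun j => runmax (e j) 0 N' x `^ r)).
rewrite [leRHS](@big_cat_nat _ _ _ J)//= lerDl; apply: sumr_ge0 => j _.
exact: powR_ge0.
Qed.

(** The diagonal truncation, [N] functions over [N] times, already exhausts the double supremum.
    Used in contrapositive form: a point where the full expression exceeds [l * s] has some
    truncation above s^r. *)
Lemma vector_maxfun_le (s : R) : 0 <= s ->
  (forall N, maxsum r N e 0 N x <= s `^ r) ->
  (poweR (\sum_(j <oo) poweR (maxfun (E j) x) r) r^-1 <= (l * s)%:E)%E.
Proof.
move=> s0 Gs.
pose u j n := runmax (e j) 0 n x `^ r.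
have um j n m : (n <= m)%N -> u j n <= u j m.
  move=> nm; rewrite /u -(subnKC nm) runmax_split; apply: ge0_ler_powR.
  - exact: ltW.
  - by rewrite nnegrE runmax_ge0.
  - by rewrite nnegrE le_max runmax_ge0.
  - by rewrite le_max lexx.
have uJ J N : \sum_(j < J) u j N <= s `^ r.
  apply: le_trans (Gs (maxn J N)).
  by apply: maxsum_mono_dim; [exact: leq_maxl|exact: leq_maxr].
pose a j := sup (range (u j)).
have aJ J : \sum_(j < J) a j <= s `^ r by apply: sum_sup_le => // N; exact: uJ.
have ua j n : u j n <= a j.
  apply: ub_le_sup; last by exists n.
  exists (s `^ r) => _ [m _ <-]; apply: le_trans (uJ j.+1 m).
  by rewrite big_ord_recr/= lerDr; apply: sumr_ge0 => i _; exact: powR_ge0.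
have a0 j : 0 <= a j by apply: le_trans (ua j 0%N); exact: powR_ge0.
have powK y : 0 <= y -> (y `^ r^-1) `^ r = y.
  by move=> y0; rewrite -powRrM mulVf ?gt_eqF// powRr1.
have powVK y : 0 <= y -> (y `^ r) `^ r^-1 = y.
  by move=> y0; rewrite -powRrM mulfV ?gt_eqF// powRr1.
have rV0 : 0 <= r^-1 by rewrite invr_ge0 ltW.
have M0 j : (0 <= maxfun (E j) x)%E.
  have E0 : range (fun n => (`|E j n x|)%:E) (`|E j 0%N x|)%:E by exists 0%N.
  by apply: le_trans (ereal_sup_ubound E0); rewrite lee_fin.
have Ma j : (poweR (maxfun (E j) x) r <= (l `^ r * a j)%:E)%E.
  have Ml : (maxfun (E j) x <= (l * a j `^ r^-1)%:E)%E.
    apply: ge_ereal_sup => _ [n _ <-]; rewrite lee_fin.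
    apply: (le_trans (eE j n)); rewrite ler_wpM2l ?(ltW l0)//.
    apply: (@le_trans _ _ (runmax (e j) 0 n.+1 x)); first by rewrite /= add0n le_max lexx orbT.
    rewrite -[leLHS]powVK ?runmax_ge0//; apply: ge0_ler_powR => //; rewrite ?nnegrE ?powR_ge0//.
    exact: ua.
  apply: le_trans (gt0_ler_poweR (ltW r0) _ _ Ml) _.
  - by rewrite in_itv/= M0 leey.
  - by rewrite in_itv/= leey andbT lee_fin mulr_ge0 ?powR_ge0// ltW.
  - by rewrite poweR_EFin lee_fin powRM ?powR_ge0 ?(ltW l0)// powK.
have S0 : (0 <= \sum_(j <oo) poweR (maxfun (E j) x) r)%E.
  by apply: nneseries_ge0 => j _ _; exact: poweR_ge0.
have Sle : (\sum_(j <oo) poweR (maxfun (E j) x) r <= ((l * s) `^ r)%:E)%E.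
  apply: lime_le; first by apply: is_cvg_nneseries => j _ _; exact: poweR_ge0.
  apply: nearW => J; rewrite big_mkord.
  apply: (@le_trans _ _ (\sum_(j < J) (l `^ r * a j)%:E)%E); first exact: lee_sum.
  rewrite sumEFin lee_fin -mulr_sumr powRM ?(ltW l0)// ler_wpM2l ?powR_ge0//.
apply: le_trans (gt0_ler_poweR rV0 _ _ Sle) _.
- by rewrite in_itv/= S0 leey.
- by rewrite in_itv/= leey andbT lee_fin powR_ge0.
- by rewrite poweR_EFin powVK// mulr_ge0// ltW.
Qed.

End VectorMaxfun.

(** Grid [N] runs from 2^N down to 2^(1-N), so it straddles [s] once [N] is large; the first of its
    points at or below [s] is at least [s / 2]. *)
Lemma dyadic_grid_point (R : realType) (s : R) N0 : 0 < s ->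
  exists N i, [/\ (N0 <= N)%N, (i < 2 * N)%N & s / 2 <= 2 ^+ N / 2 ^+ i <= s].
Proof.
move=> s0.
have pow_ge (y : R) n : 0 <= y -> (Num.truncn y < n)%N -> y <= 2 ^+ n.
  move=> y0 yn; apply: (@le_trans _ _ n%:R).
    by rewrite ltW// -truncn_lt_nat.
  by rewrite -natrX ler_nat ltnW// ltn_expl.
pose N := (N0 + (Num.truncn s).+1 + (Num.truncn s^-1).+1).+1.
have sN : s <= 2 ^+ N.
  by apply: pow_ge; [exact: ltW|rewrite /N; lia].
have sVN : s^-1 <= 2 ^+ N.-1.
  by apply: pow_ge; [rewrite invr_ge0 ltW|rewrite /N; lia].
have ex : exists i, 2 ^+ N / 2 ^+ i <= s.
  exists (N + N.-1)%N; rewrite exprD invfM mulrA mulfV ?gt_eqF// mul1r.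
  by rewrite invf_ple// posrE.
case: (ex_minnP ex) => i Hi imin.
exists N, i; split.
- by rewrite /N; lia.
- have := imin (N + N.-1)%N; rewrite exprD invfM mulrA mulfV ?gt_eqF// mul1r.
  by rewrite invf_ple ?posrE// => /(_ sVN); rewrite /N; lia.
- rewrite Hi andbT; case: i Hi imin => [|i] Hi imin.
    by rewrite expr0 divr1 (le_trans _ sN)// ler_pdivrMr// ler_peMr ?ler1n// ltW.
  have : s < 2 ^+ N / 2 ^+ i by rewrite ltNge; apply/negP => /imin; rewrite ltnn.
  by move=> /ltW h; rewrite exprS invfM mulrCA [leLHS]mulrC ler_pM2l ?invr_gt0.
Qed.

Section LevelSumLimit.
Context d (T : measurableType d) (R : realType) (P : probability T R).
Variables (phi : T -> R -> R) (r C0 : R) (G : nat -> T -> R).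
Hypotheses (phi_mono : forall x s t, 0 <= s -> s <= t -> phi x s <= phi x t)
  (phi_ge0 : forall x t, 0 <= t -> 0 <= phi x t)
  (mphi : forall t, 0 <= t -> measurable_fun setT (phi ^~ t)) (r0 : 0 < r)
  (mG : forall N, measurable_fun setT (G N))
  (Gmono : forall N M x, (N <= M)%N -> G N x <= G M x)
  (GC : forall N T0 I, 0 < T0 ->
    (\sum_(i < I) \int[P]_(x in [set x | ((T0 / 2 ^+ i) `^ r < G N x)%R])
     (phi x (T0 / 2 ^+ i))%:E <= C0%:E)%E).

(** [S] is the increasing limit of the sums of [phi x t] over the points [t] of grid [N] with t^r <
    G N x. It replaces the possibly nonmeasurable [phi] of the maximal function, at the cost of the
    factor 1/2 lost between grid points. *)
Lemma level_majorant : exists S : T -> \bar R,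
  [/\ measurable_fun setT S, (forall x, 0 <= S x)%E, (\int[P]_x S x <= C0%:E)%E &
   forall x s, 0 < s -> (exists N, s `^ r < G N x) -> ((phi x (s / 2))%:E <= S x)%E].
Proof.
pose t N i : R := 2 ^+ N / 2 ^+ i.
have t0 N i : 0 < t N i by rewrite divr_gt0 ?exprn_gt0.
pose A N i := [set x | t N i `^ r < G N x].
have mA N i : measurable (A N i) by apply: measurable_set_ltr => //; exact: measurable_cst.
pose tm N i x : \bar R := ((phi x (t N i))%:E * (\1_(A N i) x)%:E)%E.
have tm0 N i x : (0 <= tm N i x)%E by rewrite mule_ge0 ?lee_fin ?phi_ge0// ltW.
have mphit N i : measurable_fun setT (fun x => (phi x (t N i))%:E).
  by apply/measurable_EFinP; exact: mphi (ltW (t0 N i)).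
have mtm N i : measurable_fun setT (tm N i).
  by apply: emeasurable_funM => //; apply/measurable_EFinP; exact: measurable_indic.
pose S N x := (\sum_(i < 2 * N) tm N i x)%E.
have mS N : measurable_fun setT (S N) by exact: emeasurable_sum.
have S0 N x : (0 <= S N x)%E by exact: sume_ge0.
have tmS N x : (S N x <= S N.+1 x)%E.
  (* Grid [N.+1] is grid [N] shifted by one index, with one new point at each end. *)
  rewrite /S (_ : (2 * N.+1 = (2 * N).+2)%N); last by lia.
  rewrite big_ord_recl big_ord_recr /=.
  apply: (@le_trans _ _ (\sum_(i < 2 * N) tm N.+1 (lift ord0 (widen_ord (leqnSn (2 * N)) i)) x)%E).
    apply: lee_sum => i _; rewrite /tm /=.
    have tE : t N.+1 (bump 0 i) = t N i.
      by rewrite /t /bump/= add1n !exprS; field; rewrite gt_eqF// exprn_gt0.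
    rewrite tE; apply: lee_wpmul2l; first by rewrite lee_fin phi_ge0// ltW.
    rewrite lee_fin !indicE ler_nat.
    have [|//] := boolP (x \in A N i); rewrite inE /A /= => AN.
    by rewrite mem_set// /A /= tE; exact: lt_le_trans AN (Gmono _ (leqnSn N)).
  by rewrite addeCA; apply: leeDl; exact: adde_ge0.
have Snd x : nondecreasing_seq (S ^~ x) by apply/nondecreasing_seqP => N; exact: tmS.
exists (fun x => limn (S ^~ x)); split.
- apply: emeasurable_fun_cvg mS _ => x _; exact: ereal_nondecreasing_is_cvgn.
- by move=> x; apply: lime_ge; [exact: ereal_nondecreasing_is_cvgn|exact: nearW].
- rewrite monotone_convergence//; apply: lime_le.
    apply: ereal_nondecreasing_is_cvgn => N M NM; apply: ge0_le_integral => //.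
    by move=> x _; exact: Snd.
  apply: nearW => N; rewrite ge0_integral_sum//.
  apply: le_trans (GC N (2 * N) (exprn_gt0 N (ltr0n R 2))).
  apply: lee_sum => i _; rewrite -/(t N i) -/(A N i) /tm.
  rewrite [leRHS]integral_mkcond le_eqVlt; apply/orP; left; apply/eqP.
  apply: eq_integral => x _; rewrite patchE indicE; case: (x \in _).
    by rewrite mule1.
  by rewrite mule0.
- move=> x s s0 [N0 sG]; have [N [i [N0N iN /andP[st ts]]]] := dyadic_grid_point N0 s0.
  apply: (@le_trans _ _ (S N x)); last first.
    apply: lime_ge; first exact: ereal_nondecreasing_is_cvgn.
    by exists N => // M /= NM; exact: Snd.
  rewrite /S (bigD1 (Ordinal iN))//=; apply: (@le_trans _ _ (tm N i x)); last first.
    by apply: leeDl; exact: sume_ge0.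
  rewrite /tm indicE mem_set ?mule1; last first.
    rewrite /A /=; apply: le_lt_trans (lt_le_trans sG (Gmono _ N0N)).
    by apply: ge0_ler_powR; rewrite // ?nnegrE; exact: ltW.
  by rewrite lee_fin; apply: phi_mono => //; rewrite divr_ge0 ?ltW.
Qed.

End LevelSumLimit.

(** * Signed functions, normalization and conclusion *)

Lemma cexp_abs_version d (T : measurableType d) (R : realType) (P : probability T R)
    (G : set (set T)) (f E : T -> R) (l : R) : sigma_algebra setT G ->
  G `<=` measurable -> measurable_fun setT f -> 0 < l -> cexp P G f E ->
  exists e : T -> R, [/\ forall x, 0 <= e x,
    cexp_nonneg P G (EFin \o (fun x => l^-1 * `|f x|)) (EFin \o e) &
    {ae P, forall x, `|E x| <= l * e x}].
Proof.
move=> sG Gm mf l0 [_ [u [v [[u0 [mu uE]] [[v0 [mv vE]] uvE]]]]].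
(* [u + v] is a version of the conditional expectation of [|f|] and dominates [|E|]. Taking [fine]
   makes it real valued and alters it only on the null set where [u] or [v] is infinite. *)
pose e x := l^-1 * (fine (u x) + fine (v x)).
have lV0 : 0 <= l^-1 by rewrite invr_ge0 ltW.
have e0 x : 0 <= e x by rewrite mulr_ge0// addr_ge0// fine_ge0.
have mue : measurable_fun [set: g_sigma_algebraType G] (EFin \o e).
  apply/measurable_EFinP; apply: measurable_funM => //; apply: measurable_funD.
  - by apply: (measurableT_comp (fine_measurable measurableT)); exact/(GmeasurableE sG).
  - by apply: (measurableT_comp (fine_measurable measurableT)); exact/(GmeasurableE sG).
have mu' : measurable_fun setT u by apply: (sub_measurable_funS sG Gm); exact/(GmeasurableE sG).
have mv' : measurable_fun setT v by apply: (sub_measurable_funS sG Gm); exact/(GmeasurableE sG).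
exists e; split=> //.
  split; first by move=> x; rewrite lee_fin.
  split; first exact/(GmeasurableE sG).
  move=> A GA; have mA := Gm _ GA.
  transitivity (\int[P]_(x in A) ((l^-1)%:E * (u x + v x)))%E.
    apply: ge0_ae_eq_integral => //.
    - by apply: measurable_funTS; exact: (sub_measurable_funS sG Gm).
    - by apply: measurable_funeM; apply: emeasurable_funD; exact: measurable_funTS.
    - by move=> x _; rewrite lee_fin.
    - by move=> x _; rewrite mule_ge0// adde_ge0.
    move: uvE; apply: filterS => x [ufin [vfin _]] _.
    by rewrite /= /e EFinM EFinD !fineK.
  have mp : measurable_fun A (fun x => (Num.max (f x) 0)%:E).
    by apply: measurable_funTS; apply/measurable_EFinP; apply: measurable_maxr.
  have mn : measurable_fun A (fun x => (Num.max (- f x) 0)%:E).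
    apply: measurable_funTS; apply/measurable_EFinP; apply: measurable_maxr => //.
    exact: measurable_funN.
  have p0 x : (0 <= (Num.max (f x) 0)%:E)%E by rewrite lee_fin le_max lexx orbT.
  have n0 x : (0 <= (Num.max (- f x) 0)%:E)%E by rewrite lee_fin le_max lexx orbT.
  rewrite ge0_integralZl_EFin//; last 2 first.
  - by move=> x _; rewrite adde_ge0.
  - by apply: emeasurable_funD; exact: measurable_funTS.
  rewrite ge0_integralD//; [|exact: measurable_funTS|exact: measurable_funTS].
  rewrite uE// vE// -ge0_integralD// -ge0_integralZl_EFin//; last 2 first.
  - by move=> x _; rewrite adde_ge0.
  - exact: emeasurable_funD.
  apply: eq_integral => x _; rewrite -EFinD -EFinM /=; congr ((_ * _)%:E).
  case: (ger0P (f x)) => f0.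
    by rewrite max_r ?addr0// oppr_le0.
  by rewrite add0r max_l// oppr_ge0 ltW.
move: uvE; apply: filterS => x [ufin [vfin xE]].
rewrite /e mulrA mulfV ?gt_eqF// mul1r.
move: xE; rewrite -(fineK ufin) -(fineK vfin) -EFinB => -[->].
apply: (le_trans (ler_normB _ _)); rewrite !ger0_norm// fine_ge0//.
Qed.

Lemma phiE_ge d (T : measurableType d) (R : realType) (phi : T -> R -> R) x (a : R) (y : \bar R) :
  (forall s t, 0 <= s -> s <= t -> phi x s <= phi x t) -> 0 <= a -> (a%:E <= y)%E ->
  ((phi x a)%:E <= phiE phi x y)%E.
Proof.
move=> mono a0; case: y => [y| |]/=; rewrite ?leey//.
by rewrite !lee_fin => ay; exact: mono.
Qed.

Lemma lnorm_scale_le (T : Type) (R : realType) (r l : R) J (f : nat -> T -> R) x :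
  0 < r -> 0 < l -> (forall j x, 0 <= f j x) ->
  ((lnorm r J (fun j x => l^-1 * f j x) x)%:E <=
    poweR (\sum_(j <oo) ((f j x) `^ r)%:E) r^-1 * (l^-1)%:E)%E.
Proof.
move=> r0 l0 f0; have lV0 : 0 <= l^-1 by rewrite invr_ge0 ltW.
have s0 : 0 <= \sum_(j < J) f j x `^ r by apply: sumr_ge0 => j _; exact: powR_ge0.
have -> : lnorm r J (fun j x => l^-1 * f j x) x = l^-1 * (\sum_(j < J) f j x `^ r) `^ r^-1.
  rewrite /lnorm (eq_bigr (fun j : 'I_J => l^-1 `^ r * f j x `^ r)) => [|j _]; last first.
    by rewrite powRM.
  by rewrite -mulr_sumr powRM ?powR_ge0// -powRrM mulfV ?gt_eqF// powRr1.
rewrite EFinM muleC; apply: lee_wpmul2r; first by rewrite lee_fin.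
rewrite -poweR_EFin; apply: gt0_ler_poweR.
- by rewrite invr_ge0 ltW.
- by rewrite in_itv/= lee_fin s0 leey.
- rewrite in_itv/= leey andbT; apply: nneseries_ge0 => j _ _.
  by rewrite lee_fin powR_ge0.
rewrite -sumEFin -(big_mkord xpredT (fun j => (f j x `^ r)%:E)).
by apply: nneseries_lim_ge => j _ _; rewrite lee_fin powR_ge0.
Qed.

Theorem theorem3p12 (d : measure_display) (T : measurableType d) (R : realType)
  (P : probability T R) (F : nat -> set (set T)) (phi : T -> R -> R)
  (pm pp : R) :
  filtration F -> MOfun P phi ->
  lower_type phi pm -> upper_type phi pp ->
  Ainfty P F phi -> (critical_q P F phi < pm%:E)%E -> pm <= pp ->
  forall r : R, 1 < r ->
  exists C : R, 0 < C /\
    forall (f : nat -> T -> R) (E : nat -> nat -> T -> R),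
      (forall j, measurable_fun setT (f j)) ->
      (forall j n, cexp P (F n) (f j) (E j n)) ->
      (MOnorm P phi (fun x =>
         poweR (\sum_(j <oo) poweR (maxfun (E j) x) r)%E r^-1)
       <= C%:E * MOnorm P phi (fun x =>
         poweR (\sum_(j <oo) ((`| f j x |) `^ r)%:E)%E r^-1))%E.
Proof.
move=> FF MO [Cl [Cl0 lower]] [Cu [Cu0 upper]] _ crit _ r r1.
have r0 : 0 < r by exact: lt_trans ltr01 r1.
have [mono [phi0 [phi_ge0 [phioo [mphi [phi_gt0 iphi]]]]]] := MO.
(* The infimum need not be attained, but some admissible [q] lies strictly below [pm]. *)
have [_ [q [q1 Aqq] <-]] := ereal_inf_lt crit; rewrite lte_fin => qpm.
have [K0 K00 HK0] := muckenhoupt_Aq FF MO Aqq.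
pose K := Num.max K0 1; have K1 : 1 <= K by rewrite le_max lexx orbT.
have HK t : 0 < t -> muckenhoupt P F (phi ^~ t) q K.
  move=> t0 n A h l FA mh h0 l0 H; apply: le_trans (HK0 t t0 n A h l FA mh h0 l0 H) _.
  apply: lee_wpmul2r; last by rewrite lee_fin le_max lexx.
  apply: integral_ge0 => x _; rewrite lee_fin mulr_ge0 ?powR_ge0//.
  by apply: phi_ge0; exact: ltW.
have mono' x s t : 0 <= s -> s <= t -> phi x s <= phi x t.
  by move=> s0 st; apply: mono => //; rewrite in_itv/= andbT// (le_trans s0).
have [C0 C00 fin] := finite_horizon_bound FF phi_ge0 mphi phi_gt0 iphi Cl0 Cu0 lower upper q1 qpm
   K1 r1 HK.
(* At least 2, so that the lower type applies with factor 1 / C3 < 1; at least [Cl * C0], so that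
   the final modular is at most 1. The 4 in front collects two halvings: one for a strict inequality
   at the level, one from the dyadic grid. *)
pose C3 := Num.max 2 (Cl * C0).
have C32 : 2 <= C3 by rewrite le_max lexx.
have C3l : Cl * C0 <= C3 by rewrite le_max lexx orbT.
have C30 : 0 < C3 by rewrite (lt_le_trans _ C32).
exists (4 * C3); split; first by rewrite mulr_gt0.
move=> f E mf fE.
set G := fun x => _; set g := fun x => _.
(* Every [l] admissible in the norm of [g] makes [4 * C3 * l] admissible in that of [G]; an infinite
   norm of [g] is covered as an infimum over no [l]. *)
suff main l : 0 < l -> (\int[P]_x phiE phi x (g x * (l^-1)%:E) <= 1)%E ->
    (\int[P]_x phiE phi x (G x * ((4 * C3 * l)^-1)%:E) <= 1)%E.
  have C40 : 0 < 4 * C3 by rewrite mulr_gt0.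
  rewrite -lee_pdivrMl//; apply: le_ereal_inf_tmp => _ [l [l0 gl] <-].
  rewrite lee_pdivrMl// -EFinM; apply: ereal_inf_lbound; exists (4 * C3 * l) => //.
  split; first by rewrite mulr_gt0.
  exact: (main l l0 gl).
move=> l0 gl.
have [sF [Fm _]] := FF.
have /choice[e' He'] (jn : nat * nat) : exists e : T -> R, [/\ forall x, 0 <= e x,
    cexp_nonneg P (F jn.2) (EFin \o (fun x => l^-1 * `|f jn.1 x|)) (EFin \o e) &
    {ae P, forall x, `|E jn.1 jn.2 x| <= l * e x}].
  exact: cexp_abs_version.
pose e j n := e' (j, n); pose h j x := l^-1 * `|f j x|.
have lV0 : 0 <= l^-1 by rewrite invr_ge0 ltW.
have h0 j x : 0 <= h j x by rewrite mulr_ge0.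
have mh j : measurable_fun setT (h j).
  by apply: measurable_funM => //; exact: measurableT_comp.
(* The hypotheses provide versions for the [f j] only; those of their finite l^r norms are
   constructed here. *)
have /choice[D' HD'] (jn : nat * nat) : exists D, cexp_nonneg P (F jn.2) (EFin \o lnorm r jn.1 h) D.
  by apply: cexp_nonneg_ex => //; [exact: measurable_lnorm|move=> x; exact: lnorm_ge0].
have hle J : (\int[P]_x (phi x (lnorm r J h x))%:E <= 1)%E.
  apply: le_trans gl; apply: le_lower_integral => x.
    by rewrite lee_fin phi_ge0// lnorm_ge0.
  apply: phiE_ge; [exact: mono'|exact: lnorm_ge0|].
  exact: (@lnorm_scale_le _ _ r l J (fun j x => `|f j x|)).
have he j n : cexp_nonneg P (F n) (EFin \o h j) (EFin \o e j n) by have [] := He' (j, n).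
have mmax N : measurable_fun setT (maxsum r N e 0 N).
  apply: measurable_maxsum => j i _; apply/measurable_EFinP.
  exact: (cexp_measurable FF (he j (0 + i)%N)).
have [S [mS S0 intS Sphi]] := level_majorant mono' phi_ge0 mphi r0 mmax
  (fun N M x NM => maxsum_mono_dim r1 e x NM NM)
  (fun N T0 I T00 => fin N N h e (fun n => D' (N, n)) mh h0 he
     (fun n => HD' (N, n)) (hle N) T0 I T00).
have [N0 [mN0 PN0 Nsub]] : {ae P, forall x, forall j n, `|E j n x| <= l * e j n x}.
  apply/ae_foralln => j; apply/ae_foralln => n.
  by have [_ _] := He' (j, n).
have claim x s : ~ N0 x -> 0 < s -> ((l * s)%:E < G x)%E -> ((phi x (s / 2))%:E <= S x)%E.
  move=> nN0 s0 sG; apply: Sphi => //; apply: contrapT => nN.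
  have Ee : forall j n, `|E j n x| <= l * e j n x.
    by apply: contrapT => H; apply: nN0; exact: Nsub.
  move: sG; rewrite ltNge => /negP; apply.
  have Gs N : maxsum r N e 0 N x <= s `^ r.
    by rewrite leNgt; apply/negP => sN; apply: nN; exists N.
  exact: (vector_maxfun_le r1 l0 Ee (ltW s0) Gs).
(* The comparison of lower integrals is pointwise everywhere, so the exceptional null set is covered
   by adding a function that is infinite there and has integral 0. *)
pose Z := (cst +oo%E \_ N0) : T -> \bar R.
have cC0 : 0 <= Cl / C3 by rewrite divr_ge0 ?ltW.
have mZ : measurable_fun setT Z.
  by apply/(measurable_restrictT (cst +oo%E) mN0); exact: measurable_cst.
have Z0 x : (0 <= Z x)%E by apply: erestrict_ge0 => y _ /=; rewrite leey.
have c0 : 0 < (4 * C3 * l)^-1 by rewrite invr_gt0 !mulr_gt0.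
have G0 x : (0 <= G x)%E by exact: poweR_ge0.
have phiE_ge0 x y : (0 <= y)%E -> (0 <= phiE phi x y)%E.
  by case: y => [y| |]//=; rewrite !lee_fin; exact: phi_ge0.
apply: (@le_trans _ _ (\int[P]_x ((Cl / C3)%:E * S x + Z x))%E).
  apply: le_lower_integral => x.
    by apply: phiE_ge0; apply: mule_ge0 => //; rewrite lee_fin ltW.
  have cS0 : (0 <= (Cl / C3)%:E * S x)%E by rewrite mule_ge0.
  have [xN|xN] := pselect (N0 x).
    by rewrite /Z patchE mem_set// /cst addey ?leey// gt_eqF// (lt_le_trans _ cS0)// ltNyr.
  apply: (@le_trans _ _ ((Cl / C3)%:E * S x)%E); last by apply: leeDl.
  have := claim x _ xN; have := G0 x; case: (G x) => [y| |//] y0 cl.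
    rewrite -EFinM /=; move: y0; rewrite lee_fin le_eqVlt => /orP[/eqP<-|y0].
      by rewrite mul0r phi0.
    (* With s = y / (2 l) the level l s = y / 2 lies strictly below [G x], and [S] dominates [phi]
       at s / 2 = y / (4 l). *)
    have yl0 : 0 < y / (2 * l) by rewrite divr_gt0// mulr_gt0.
    have /cl : 0 < y / (2 * l) by [].
    have -> : l * (y / (2 * l)) = y / 2 by field; rewrite gt_eqF.
    rewrite lte_fin ltr_pdivrMr// ltr_pMr// ltr1n => /(_ isT) Sy.
    apply: le_trans (lee_wpmul2l _ Sy); last by rewrite lee_fin.
    rewrite -EFinM lee_fin.
    have -> : y * (4 * C3 * l)^-1 = C3^-1 * (y / (2 * l) / 2).
      by field; rewrite !gt_eqF.
    have C31 : 0 < C3^-1 < 1.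
      by rewrite invr_gt0 C30/= invf_lt1// (lt_le_trans _ C32)// ltr1n.
    have y20 : 0 <= y / (2 * l) / 2 by rewrite divr_ge0// ltW.
    apply: (le_trans (lower x _ _ y20 C31)).
    rewrite ler_wpM2r ?phi_ge0// ler_wpM2l ?(ltW Cl0)//.
    have /andP[C3p C3l1] := C31.
    by apply: ge1r_powR; [rewrite C3p ltW|rewrite (le_trans q1)// ltW].
  (* Where [G x] is infinite, [S x] dominates [phi x t] for every positive [t], hence is infinite
     because [phi x] tends to [+oo]. *)
  rewrite gt0_mulye ?lte_fin//=.
  suff -> : S x = +oo%E by rewrite gt0_muley ?leey// lte_fin divr_gt0.
  apply/eqyP => A A0.
  have /cvgryPge/(_ A) [M [_ HM]] := phioo x.
  pose t := Num.max 1 (M + 1).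
  have t0 : 0 < t by rewrite lt_max ltr01.
  have /HM At : M < t by rewrite lt_max ltrDl ltr01 orbT.
  apply: (@le_trans _ _ (phi x t)%:E); first by rewrite lee_fin.
  have := cl (2 * t); rewrite (mulrC 2) mulfK//; apply; first by rewrite mulr_gt0.
  exact: ltry.
rewrite ge0_integralD//; last 2 first.
- by move=> x _; rewrite mule_ge0.
- exact: measurable_funeM.
have -> : (\int[P]_x Z x = 0)%E.
  rewrite /Z -integral_mkcond; exact: (null_set_integral mN0 (measurable_cst _) PN0).
rewrite adde0 ge0_integralZl_EFin//.
apply: le_trans (lee_wpmul2l _ intS) _; first by rewrite lee_fin.
by rewrite -EFinM lee_fin mulrAC ler_pdivrMr// mul1r.
Qed.
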